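(* Let $\Bbbk\to A\xrightarrow{\iota}B\xrightarrow{\pi}C\to\Bbbk$ be an exact sequence of Hopf algebras over a field $\Bbbk$, with $B$ faithfully coflat as a right $C$-comodule (via $(\mathrm{id}\otimes\pi)\Delta$). Then $B$ is co-Frobenius if and only if $A$ and $C$ are co-Frobenius.
   Context: A sequence of Hopf algebra maps $\Bbbk\to A\xrightarrow{\iota}B\xrightarrow{\pi}C\to\Bbbk$ is exact if $\iota$ is injective, $\pi$ is surjective, $\ker\pi=B\iota(A)^+$ (where $A^+=\ker\varepsilon_A$), and $B^{\mathrm{co}\,C}:=\{b\in B:(\mathrm{id}\otimes\pi)\Delta(b)=b\otimes1\}=\iota(A)$. A Hopf algebra $L$ is co-Frobenius if there is a nonzero linear map $\int:L\to\Bbbk$ with $\int(h_{(2)})h_{(1)}=\int(h)1_L$ for all $h\in L$. *)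

(* Defs.v *)
(* Hopf algebras over a field, encoded via Sweedler-style
   finite sums and the universal property of the tensor product. *)
From HB Require Import structures.
From mathcomp Require Import all_boot all_order all_algebra.
Set Implicit Arguments. Unset Strict Implicit. Unset Printing Implicit Defensive.
Import GRing.Theory.
Local Open Scope ring_scope.

Definition lin {k : fieldType} {V W : lmodType k} (f : V -> W) : Prop :=
  forall (a : k) (x y : V), f (a *: x + y) = a *: f x + f y.

Definition linf {k : fieldType} {V : lmodType k} (f : V -> k) : Prop :=
  forall (a : k) (x y : V), f (a *: x + y) = a * f x + f y.

Definition bilin {k : fieldType} {U V X : lmodType k} (phi : U -> V -> X) : Prop :=
  (forall y, lin (fun x => phi x y)) /\ (forall x, lin (phi x)).

Definition trilin {k : fieldType} {U V W X : lmodType k}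
  (phi : U -> V -> W -> X) : Prop :=
  (forall y z, lin (fun x => phi x y z)) /\ (forall x z, lin (fun y => phi x y z))
  /\ (forall x y, lin (phi x y)).

(* ---------- tensors as finite formal sums ---------------------------------
   A list s = [:: (x_1,y_1); ...] represents sum_i x_i (x) y_i in U (x) V.
   Two such lists represent the same element of U (x) V iff every bilinear
   map out of U x V agrees on them (universal property of (x)). *)
Definition teq2 {k : fieldType} {U V : lmodType k} (s t : seq (U * V)) : Prop :=
  forall (X : lmodType k) (phi : U -> V -> X), bilin phi ->
    \sum_(p <- s) phi p.1 p.2 = \sum_(p <- t) phi p.1 p.2.

Definition teq3 {k : fieldType} {U V W : lmodType k}
  (s t : seq (U * V * W)) : Prop :=
  forall (X : lmodType k) (phi : U -> V -> W -> X), trilin phi ->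
    \sum_(p <- s) phi p.1.1 p.1.2 p.2 = \sum_(p <- t) phi p.1.1 p.1.2 p.2.

(* delta h is a Sweedler representative  sum h_(1) (x) h_(2) of Delta(h). *)
Definition is_hopf {k : fieldType} {H : algType k}
  (delta : H -> seq (H * H)) (eps : H -> k) (S : H -> H) : Prop :=
  [/\
      (forall (a : k) (x y : H),
         teq2 (delta (a *: x + y)) ([seq (a *: p.1, p.2) | p <- delta x] ++ delta y)),
      (forall h : H,
         teq3 [seq (q.1, q.2, p.2) | p <- delta h, q <- delta p.1]
              [seq (p.1, q.1, q.2) | p <- delta h, q <- delta p.2]),
      linf eps /\
      (forall h : H, \sum_(p <- delta h) eps p.1 *: p.2 = h /\
                     \sum_(p <- delta h) eps p.2 *: p.1 = h),
      [/\ (forall a b : H,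
             teq2 (delta (a * b)) [seq (p.1 * q.1, p.2 * q.2) | p <- delta a, q <- delta b]),
          teq2 (delta 1) [:: (1, 1)],
          (forall a b : H, eps (a * b) = eps a * eps b) &
          eps 1 = 1] &
      lin S /\
      (forall h : H, \sum_(p <- delta h) S p.1 * p.2 = eps h *: 1 /\
                     \sum_(p <- delta h) p.1 * S p.2 = eps h *: 1)].

Record hopf {k : fieldType} (H : algType k) := Hopf {
  hdelta : H -> seq (H * H);
  heps : H -> k;
  hS : H -> H;
  hopf_ax : is_hopf hdelta heps hS }.

(* Hopf algebra maps (= bialgebra maps) *)
Definition is_hopf_map {k : fieldType} {H1 H2 : algType k}
  (h1 : hopf H1) (h2 : hopf H2) (f : H1 -> H2) : Prop :=
  [/\ lin f, f 1 = 1, (forall a b, f (a * b) = f a * f b),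
      (forall a, teq2 (hdelta h2 (f a)) [seq (f p.1, f p.2) | p <- hdelta h1 a]) &
      (forall a, heps h2 (f a) = heps h1 a)].

Definition exact_hopf_seq {k : fieldType} {A B C : algType k}
  (hA : hopf A) (hB : hopf B) (hC : hopf C) (iota : A -> B) (pi : B -> C) : Prop :=
  [/\ is_hopf_map hA hB iota /\ is_hopf_map hB hC pi,
      injective iota, (forall c : C, exists b : B, pi b = c),
      (forall b : B, pi b = 0 <->
         exists s : seq (B * A), (forall p, p \in s -> heps hA p.2 = 0) /\
                                 b = \sum_(p <- s) p.1 * iota p.2) &
      (forall b : B, teq2 [seq (p.1, pi p.2) | p <- hdelta hB b] [:: (b, 1)] <->
                     exists a : A, b = iota a)].

Definition co_frobenius {k : fieldType} {L : algType k} (hL : hopf L) : Prop :=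
  exists int : L -> k,
    [/\ linf int, (exists h, int h != 0) &
        (forall h : L, \sum_(p <- hdelta hL h) int p.2 *: p.1 = int h *: 1)].

Definition is_lcomod {k : fieldType} {C : algType k} (hC : hopf C)
  {M : lmodType k} (rho : M -> seq (C * M)) : Prop :=
  [/\ (forall (a : k) (x y : M),
         teq2 (rho (a *: x + y)) ([seq (p.1, a *: p.2) | p <- rho x] ++ rho y)),
      (forall m : M,
         teq3 [seq (q.1, q.2, p.2) | p <- rho m, q <- hdelta hC p.1]
              [seq (p.1, q.1, q.2) | p <- rho m, q <- rho p.2]) &
      (forall m : M, \sum_(p <- rho m) heps hC p.1 *: p.2 = m)].

Definition is_comod_map {k : fieldType} {C : algType k}
  {M N : lmodType k} (rhoM : M -> seq (C * M)) (rhoN : N -> seq (C * N))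
  (f : M -> N) : Prop :=
  lin f /\ forall m, teq2 (rhoN (f m)) [seq (p.1, f p.2) | p <- rhoM m].

(* u in B (x) M lies in the cotensor product B []_C M, where B is a right
   C-comodule via (id (x) pi) Delta *)
Definition in_cotensor {k : fieldType} {B C : algType k} (hB : hopf B) (pi : B -> C)
  {M : lmodType k} (rho : M -> seq (C * M)) (u : seq (B * M)) : Prop :=
  teq3 [seq (q.1, pi q.2, p.2) | p <- u, q <- hdelta hB p.1]
       [seq (p.1, q.1, q.2) | p <- u, q <- rho p.2].

Definition tmap2 {k : fieldType} {B : algType k} {M N : lmodType k}
  (f : M -> N) (u : seq (B * M)) : seq (B * N) := [seq (p.1, f p.2) | p <- u].

Definition exact_at {k : fieldType} {M1 M2 M3 : lmodType k}
  (f : M1 -> M2) (g : M2 -> M3) : Prop :=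
  (forall x, g (f x) = 0) /\ (forall y, g y = 0 -> exists x, y = f x).

Definition cot_exact_at {k : fieldType} {B C : algType k} (hB : hopf B) (pi : B -> C)
  {M1 M2 M3 : lmodType k} (rho1 : M1 -> seq (C * M1)) (rho2 : M2 -> seq (C * M2))
  (f : M1 -> M2) (g : M2 -> M3) : Prop :=
  (forall v, in_cotensor hB pi rho1 v -> teq2 (tmap2 g (tmap2 f v)) [::]) /\
  (forall u, in_cotensor hB pi rho2 u -> teq2 (tmap2 g u) [::] ->
     exists v, in_cotensor hB pi rho1 v /\ teq2 (tmap2 f v) u).

Definition faithfully_coflat {k : fieldType} {B C : algType k} (hB : hopf B)
  (hC : hopf C) (pi : B -> C) : Prop :=
  forall (M1 M2 M3 : lmodType k) (rho1 : M1 -> seq (C * M1))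
         (rho2 : M2 -> seq (C * M2)) (rho3 : M3 -> seq (C * M3))
         (f : M1 -> M2) (g : M2 -> M3),
    is_lcomod hC rho1 -> is_lcomod hC rho2 -> is_lcomod hC rho3 ->
    is_comod_map rho1 rho2 f -> is_comod_map rho2 rho3 g ->
    (exact_at f g <-> cot_exact_at hB pi rho1 rho2 f g).

(* Main.v *)
(* Everything rests on the formula  x_1 int(y x_2) = S(y_1) int(y_2 x)  for a
   left integral int.

   If A and C have integrals, then E(b) = b_1 int_C(pi(b_2)) takes values in the
   coinvariants iota(A) and is left A-linear, so int_A o iota^-1 o E is an integral
   on B; it is nonzero because x |-> int_A(x a) vanishes for a = 0 only.

   Conversely, a nonzero functional f such that x_1 f(x_2) stays in a
   finite-dimensional space can be turned into a nonzero integral (the fundamental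
   theorem of Hopf modules for the rational part of the dual).  On A, such a
   functional is a |-> int_B(b iota(a)).  On C, one works with a right integral of B
   and asks for f with f(1) = 1 and f(c_1) c_2 in the span Z of the pi(S(b_2)).  By
   linear algebra f exists unless 1 = sum_i c^i_1 g_i(c^i_2) with all g_i vanishing
   on Z.  In that case 1 lies in the image of the colinear map C^n -> C given by this
   formula, so coflatness applied to C^n -> C -> coker lifts the relation to
   1 = sum_i b^i_1 g_i(pi(b^i_2)) in B, and integrating against b gives int(b) = 0.

   Linear independence is never used directly: it is replaced by finite families of
   pairs (w_i, g_i) with v = sum_i g_i(v) w_i on a given finite-dimensional space. *)
Require Import Defs.
From HB Require Import structures.
From mathcomp Require Import all_boot all_order all_algebra.
From mathcomp Require Import boolp classical_sets.
Set Implicit Arguments. Unset Strict Implicit. Unset Printing Implicit Defensive.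
Import GRing.Theory.
Local Open Scope ring_scope.

(** * Linear maps and functionals *)

Section LinearMaps.
Variable k : fieldType.
Implicit Types U V W X : lmodType k.

Lemma linD V W (f : V -> W) x y : lin f -> f (x + y) = f x + f y.
Proof. by move=> lf; rewrite -[x]scale1r lf !scale1r. Qed.

Lemma lin0 V W (f : V -> W) : lin f -> f 0 = 0.
Proof. by move=> lf; have := lf (-1) 0 0; rewrite scaleN1r addr0 oppr0 scaleN1r addNr. Qed.

Lemma linZ V W (f : V -> W) a x : lin f -> f (a *: x) = a *: f x.
Proof. by move=> lf; rewrite -[a *: x]addr0 lf (lin0 lf) addr0. Qed.

Lemma linB V W (f : V -> W) x y : lin f -> f (x - y) = f x - f y.
Proof. by move=> lf; rewrite -[- y]scaleN1r addrC lf scaleN1r addrC. Qed.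

Lemma lin_sum V W I (r : seq I) (f : V -> W) F :
  lin f -> f (\sum_(i <- r) F i) = \sum_(i <- r) f (F i).
Proof.
move=> lf; elim: r => [|i r IH]; first by rewrite !big_nil lin0.
by rewrite !big_cons linD // IH.
Qed.

Lemma linfE V (f : V -> k) : linf f = @lin k V k^o f.
Proof. by []. Qed.

Lemma lin_id V : lin (fun x : V => x). Proof. by []. Qed.

Lemma lin_comp U V W (g : V -> W) (f : U -> V) :
  lin g -> lin f -> lin (fun x => g (f x)).
Proof. by move=> lg lf a x y; rewrite lf lg. Qed.

Lemma lin_add V W (f g : V -> W) : lin f -> lin g -> lin (fun x => f x + g x).
Proof. by move=> lf lg a x y; rewrite lf lg scalerDr addrACA. Qed.

Lemma lin_scale V W (a : k) (f : V -> W) : lin f -> lin (fun x => a *: f x).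
Proof. by move=> lf b x y; rewrite lf scalerDr !scalerA mulrC. Qed.

Lemma lin_scalel V W (f : V -> k) (w : W) : linf f -> lin (fun x => f x *: w).
Proof. by move=> lf b x y; rewrite lf scalerDl scalerA. Qed.

Lemma lin_bigsum V W I (r : seq I) (F : I -> V -> W) :
  (forall i, lin (F i)) -> lin (fun x => \sum_(i <- r) F i x).
Proof.
move=> lF a x y; rewrite scaler_sumr -big_split /=.
by apply: eq_bigr => i _; rewrite lF.
Qed.

Lemma lin_mull V (A : algType k) (a : A) (f : V -> A) :
  lin f -> lin (fun x => a * f x).
Proof. by move=> lf b x y; rewrite lf mulrDr scalerAr. Qed.

Lemma lin_mulr V (A : algType k) (a : A) (f : V -> A) :
  lin f -> lin (fun x => f x * a).
Proof. by move=> lf b x y; rewrite lf mulrDl scalerAl. Qed.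

Lemma linf_mull V (a : k) (f : V -> k) : linf f -> linf (fun x => a * f x).
Proof. by move=> lf b x y; rewrite lf mulrDr mulrCA. Qed.

Lemma linf_mulr V (a : k) (f : V -> k) : linf f -> linf (fun x => f x * a).
Proof. by move=> lf b x y; rewrite lf mulrDl mulrA. Qed.

Record is_subspace V (P : V -> Prop) : Prop := IsSubspace {
  subspace0 : P 0;
  subspaceL : forall a x y, P x -> P y -> P (a *: x + y) }.

Lemma subspaceZ V (P : V -> Prop) a x : is_subspace P -> P x -> P (a *: x).
Proof. by move=> sP Px; rewrite -[_ *: _]addr0; apply: subspaceL sP _ _ _ Px (subspace0 sP). Qed.

Lemma separation V (P : V -> Prop) v : is_subspace P -> ~ P v ->
  exists f : V -> k, [/\ linf f, forall x, P x -> f x = 0 & f v = 1].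
Proof.
move=> sP nPv.
(* A maximal subspace containing P and avoiding v is a hyperplane complementary
   to v; the empty set is allowed because of the empty chain. *)
pose closed (A : set V) := forall a x y, A x -> A y -> A (a *: x + y).
pose good : set (set V) := fun A =>
  [/\ A = set0 \/ (P `<=` A)%classic, closed A & ~ A v].
have [F Fgood Ftot|A [[A0 clA nAv] Amax]] := @Zorn_bigcup V good.
  split.
  - have [[X [FX PX]]|nX] := pselect (exists X : set V, F X /\ (P `<=` X)%classic).
      by right=> x Px; exists X => //; apply: PX.
    left; apply/seteqP; split=> // x [X FX Xx].
    have [[X0|PX] _ _] := Fgood _ FX; first by move: Xx; rewrite X0.
    by case: nX; exists X.
  - move=> a x y [X FX Xx] [Y FY Yy].
    have [XY|YX] := Ftot _ _ FX FY.
      by exists Y => //; have [_ clY _] := Fgood _ FY; apply: clY => //; apply: XY.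
    by exists X => //; have [_ clX _] := Fgood _ FX; apply: clX => //; apply: YX.
  - by case=> X FX Xv; have [_ _] := Fgood _ FX; apply.
have PA : (P `<=` A)%classic.
  case: A0 => // A0; exfalso; apply: (Amax P).
    split; first by rewrite A0.
    by rewrite A0 => /(_ 0); apply; exact: subspace0 sP.
  by split=> //; [right | exact: subspaceL sP].
have A_0 : A 0 by apply: PA; exact: subspace0 sP.
(* For x outside [A], maximality forces v into the larger subspace A + kx, and the resulting
   relation is solved for x. *)
have dec x : exists c : k, A (x - c *: v).
  have [Ax|nAx] := pselect (A x); first by exists 0; rewrite scale0r subr0.
  pose A' : set V := fun y => exists c, A (y - c *: x).
  have [[c Avc]|nA'v] := pselect (A' v).
    have [c0|c0] := eqVneq c 0; first by move: Avc; rewrite c0 scale0r subr0.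
    exists c^-1; have := clA (- c^-1) _ _ Avc A_0; rewrite addr0 scalerBr scalerA.
    by rewrite mulNr mulVf // scaleN1r opprK addrC scaleNr.
  exfalso; apply: (Amax A'); last first.
    split=> //.
      by right=> y Py; exists 0; rewrite scale0r subr0; apply: PA.
    move=> a y z [c Ay] [d Az]; exists (a * c + d).
    have := clA a _ _ Ay Az; rewrite scalerBr scalerA addrACA -opprD.
    by rewrite -scalerDl.
  split; first by move=> y Ay; exists 0; rewrite scale0r subr0.
  by move=> /(_ x) A'A; apply/nAx/A'A; exists 1; rewrite scale1r subrr.
have uniq_dec x c d : A (x - c *: v) -> A (x - d *: v) -> c = d.
  move=> Ac Ad; apply/eqP; rewrite -subr_eq0; apply/negP=> /negP cd0.
  apply: nAv; have := clA (-1) _ _ Ac Ad.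
  rewrite scaleN1r opprB addrA subrK -scalerBl => Acd.
  have := clA (c - d)^-1 _ _ Acd A_0.
  by rewrite addr0 scalerA mulVf // scale1r.
have [f fP] := choice dec; exists f; split.
- move=> a x y; apply: uniq_dec (fP _) _.
  have := clA a _ _ (fP x) (fP y).
  by rewrite scalerBr scalerA addrACA -opprD -scalerDl.
- by move=> x Px; apply: uniq_dec (fP _) _; rewrite scale0r subr0; apply: PA.
- by apply: uniq_dec (fP _) _; rewrite scale1r subrr.
Qed.

Lemma functionals_separate V (v : V) :
  (forall f : V -> k, linf f -> f v = 0) -> v = 0.
Proof.
move=> fv0; apply/eqP/negP=> v0.
have [||f [lf _ fv1]] := @separation V (fun x => x = 0) v.
- by split=> // a x y -> ->; rewrite scaler0 addr0.
- by move=> vE; apply: v0; rewrite vE.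
by move: (fv0 f lf); rewrite fv1 => /eqP; rewrite oner_eq0.
Qed.

Record dual V := Dual { dual_fun :> V -> k; dual_linf : linf dual_fun }.

(* The linear span, described as a double annihilator. *)
Definition span V (zs : seq V) : V -> Prop := fun v =>
  forall f : V -> k, linf f -> (forall z, z \in zs -> f z = 0) -> f v = 0.

Lemma mem_span V (zs : seq V) z : z \in zs -> span zs z.
Proof. by move=> zz f _; apply. Qed.

Lemma span_subspace V (zs : seq V) : is_subspace (span zs).
Proof.
split=> [f lf _|a x y sx sy f lf fz]; first by rewrite (lin0 (lf : @lin _ V k^o f)).
by rewrite lf sx // sy // mulr0 addr0.
Qed.

(** Induction on [zs]: when [e z] is new, [separation] gives g with g(e z) = 1 that kills the
    earlier vectors, and the earlier functionals are corrected by multiples of g so as to kill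
    [e z]. Indexing through [e] keeps preimages of the vectors at hand, as needed later for an
    injection [iota]. *)
Lemma finite_projection_map V (I : eqType) (e : I -> V) (zs : seq I) :
  exists t : seq (I * dual V),
    forall v, span (map e zs) v -> v = \sum_(p <- t) p.2 v *: e p.1.
Proof.
elim: zs => [|z zs [t tP]].
  exists [::] => v sv; rewrite big_nil; apply: functionals_separate => f lf.
  exact: sv.
have [sz|nsz] := pselect (span (map e zs) (e z)).
  exists t => v sv; apply: tP => f lf fz; apply: sv => // y.
  by rewrite inE => /orP[/eqP ->|/fz //]; apply: sz.
have [g [lg gz gz1]] := separation (span_subspace _) nsz.
have lg' (p : I * dual V) : linf (fun v => p.2 v - p.2 (e z) * g v).
  move=> a x y; rewrite lg (dual_linf p.2).
  by rewrite mulrDr opprD addrACA mulrBr mulrCA.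
exists ((z, Dual lg) :: [seq (p.1, Dual (lg' p)) | p <- t]) => v sv.
rewrite big_cons big_map /=.
have sv' : span (map e zs) (v - g v *: e z).
  move=> f lf fz.
  have lh : linf (fun y => f y - f (e z) * g y).
    by move=> a x y; rewrite lg lf mulrDr opprD addrACA mulrBr mulrCA.
  rewrite (linB _ _ (lf : @lin _ V k^o f)) (linZ _ _ (lf : @lin _ V k^o f)).
  rewrite /GRing.scale /= mulrC; apply: (sv (fun y => f y - f (e z) * g y)) => // y.
  rewrite inE => /orP[/eqP ->|zy]; first by rewrite gz1 mulr1 subrr.
  by rewrite fz // gz ?mulr0 ?subr0 //; apply: mem_span.
rewrite -{1}[v](subrK (g v *: e z)) {1}(tP _ sv') addrC; congr (_ + _).
apply: eq_bigr => p _; congr (_ *: _).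
have lp : @lin _ V k^o p.2 := dual_linf p.2.
by rewrite (linB _ _ lp) (linZ _ _ lp) /GRing.scale /= mulrC.
Qed.

Lemma finite_projection V (zs : seq V) :
  exists t : seq (V * dual V),
    forall v, span zs v -> v = \sum_(p <- t) p.2 v *: p.1.
Proof. by have := finite_projection_map id zs; rewrite map_id. Qed.

End LinearMaps.

(** * Sweedler sums *)

(* The value at the tensor s of the linear map induced by F; with s = hdelta h x
   this is the Sweedler sum of the F x_(1) x_(2). *)
Definition sw {k : fieldType} {U V X : lmodType k} (s : seq (U * V))
  (F : U -> V -> X) : X := \sum_(p <- s) F p.1 p.2.

Section SweedlerSums.
Variable k : fieldType.
Implicit Types U V W X Y : lmodType k.

Lemma eq_sw U V X (s : seq (U * V)) (F G : U -> V -> X) :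
  (forall a b, F a b = G a b) -> sw s F = sw s G.
Proof. by move=> FG; apply: eq_bigr => p _; apply: FG. Qed.

Lemma eq_in_sw U V X (s : seq (U * V)) (F G : U -> V -> X) :
  (forall a b, (a, b) \in s -> F a b = G a b) -> sw s F = sw s G.
Proof.
by move=> FG; rewrite /sw !big_seq; apply: eq_bigr => -[a b] abs; apply: FG.
Qed.

Lemma lin_sw_out U V X Y (G : X -> Y) (s : seq (U * V)) (F : U -> V -> X) :
  lin G -> G (sw s F) = sw s (fun a b => G (F a b)).
Proof. by move=> lG; rewrite /sw (lin_sum _ _ lG). Qed.

Lemma sw_exch U V U' V' X (s : seq (U * V)) (t : seq (U' * V'))
    (F : U -> V -> U' -> V' -> X) :
  sw s (fun a b => sw t (fun c d => F a b c d)) =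
  sw t (fun c d => sw s (fun a b => F a b c d)).
Proof. exact: exchange_big. Qed.

Lemma sw_sum U V X I (s : seq (U * V)) (r : seq I) (F : I -> U -> V -> X) :
  sw s (fun a b => \sum_(i <- r) F i a b) = \sum_(i <- r) sw s (F i).
Proof. exact: exchange_big. Qed.

Lemma sw_scale U V X (s : seq (U * V)) c (F : U -> V -> X) :
  sw s (fun a b => c *: F a b) = c *: sw s F.
Proof. by rewrite /sw scaler_sumr. Qed.

Lemma sw_mull U V (A : algType k) (s : seq (U * V)) (c : A) (F : U -> V -> A) :
  sw s (fun a b => c * F a b) = c * sw s F.
Proof. by rewrite /sw mulr_sumr. Qed.

Lemma sw_mulr U V (A : algType k) (s : seq (U * V)) (c : A) (F : U -> V -> A) :
  sw s (fun a b => F a b * c) = sw s F * c.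
Proof. by rewrite /sw mulr_suml. Qed.

Lemma sw0 U V X (s : seq (U * V)) : sw s (fun _ _ => 0 : X) = 0.
Proof. by rewrite /sw big1. Qed.

Lemma lin_sw U V W X (s : seq (U * V)) (F : W -> U -> V -> X) :
  (forall a b, lin (fun x => F x a b)) -> lin (fun x => sw s (F x)).
Proof. by move=> lF; apply: lin_bigsum => p; apply: lF. Qed.

Lemma sw_swap U V X (s : seq (U * V)) (F : V -> U -> X) :
  sw [seq (p.2, p.1) | p <- s] F = sw s (fun a b => F b a).
Proof. by rewrite /sw big_map. Qed.

End SweedlerSums.

(** * Hopf algebra axioms as identities of Sweedler sums *)

Section HopfBasics.
Variables (k : fieldType) (H : algType k) (h : hopf H).
Local Notation d := (hdelta h).
Local Notation eps := (heps h).
Local Notation S := (hS h).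

Lemma lin_antipode : lin S.
Proof. by case: h => dl e s [] ? ? ? ? []. Qed.

Lemma linf_counit : linf eps.
Proof. by case: h => dl e s [] ? ? []. Qed.

Lemma lin_counit : @lin k H k^o eps.
Proof. exact: linf_counit. Qed.

Lemma lin_delta (W X : lmodType k) (F : H -> H -> X) (f : W -> H) :
  bilin F -> lin f -> lin (fun x => sw (d (f x)) F).
Proof.
case: h => dl e s [] /= dlin _ _ _ _ bF lf a x y.
rewrite lf /sw (dlin a (f x) (f y) X F bF) big_cat big_map /=; congr (_ + _).
rewrite scaler_sumr; apply: eq_bigr => p _ /=.
exact: (linZ _ _ (bF.1 _)).
Qed.

Lemma sw_coassoc (X : lmodType k) (F : H -> H -> H -> X) x : trilin F ->
  sw (d x) (fun a c => sw (d a) (fun a' b => F a' b c)) =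
  sw (d x) (fun a b => sw (d b) (F a)).
Proof.
case: h => dl e s [] /= _ dcoa _ _ _ tF.
by have := dcoa x X F tF; rewrite !big_allpairs_dep /=.
Qed.

Lemma sw_counitl (X : lmodType k) (F : H -> X) x : lin F ->
  sw (d x) (fun a b => eps a *: F b) = F x.
Proof.
case: h => dl e s [] /= _ _ [_ eP] _ _ lF.
rewrite -[in RHS](eP x).1 (lin_sum _ _ lF); apply: eq_bigr => p _.
by rewrite (linZ _ _ lF).
Qed.

Lemma sw_counitr (X : lmodType k) (F : H -> X) x : lin F ->
  sw (d x) (fun a b => eps b *: F a) = F x.
Proof.
case: h => dl e s [] /= _ _ [_ eP] _ _ lF.
rewrite -[in RHS](eP x).2 (lin_sum _ _ lF); apply: eq_bigr => p _.
by rewrite (linZ _ _ lF).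
Qed.

Lemma sw_mul (X : lmodType k) (F : H -> H -> X) x y : bilin F ->
  sw (d (x * y)) F =
  sw (d x) (fun a b => sw (d y) (fun a' b' => F (a * a') (b * b'))).
Proof.
case: h => dl e s [] /= _ _ _ [dM _ _ _] _ bF.
by have := dM x y X F bF; rewrite big_allpairs_dep.
Qed.

Lemma sw_one (X : lmodType k) (F : H -> H -> X) : bilin F -> sw (d 1) F = F 1 1.
Proof.
case: h => dl e s [] /= _ _ _ [_ d1 _ _] _ bF.
by have := d1 X F bF; rewrite big_seq1.
Qed.

Lemma counitM x y : eps (x * y) = eps x * eps y.
Proof. by case: h => dl e s [] /= _ _ _ [_ _ eM _] _. Qed.

Lemma counit1 : eps 1 = 1.
Proof. by case: h => dl e s [] /= _ _ _ [_ _ _ ->] _. Qed.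

Lemma sw_antipodel (X : lmodType k) (F : H -> X) x : lin F ->
  sw (d x) (fun a b => F (S a * b)) = eps x *: F 1.
Proof.
case: h => dl e s [] /= _ _ _ _ [_ sP] lF.
by rewrite -(linZ _ _ lF) -(sP x).1 (lin_sum _ _ lF).
Qed.

Lemma sw_antipoder (X : lmodType k) (F : H -> X) x : lin F ->
  sw (d x) (fun a b => F (a * S b)) = eps x *: F 1.
Proof.
case: h => dl e s [] /= _ _ _ _ [_ sP] lF.
by rewrite -(linZ _ _ lF) -(sP x).2 (lin_sum _ _ lF).
Qed.

End HopfBasics.

Ltac lin_leaf :=
  first [ assumption | exact: lin_id | exact: lin_antipode | exact: linf_counit
        | exact: (dual_linf _)
        | match goal with
          | bF : bilin ?F |- lin (?F ?a) => exact: (bF.2 a)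
          | bF : bilin ?F |- lin (fun x => ?F x ?b) => exact: (bF.1 b)
          end ].

(** A [linf] goal is turned into linearity into [k^o], so that one set of rules handles maps and
    functionals. *)
Ltac lin_step :=
  lazymatch goal with
  | |- trilin _ => split; [|split]; move=> ? ? /=
  | |- bilin _ => first [assumption | split; move=> ? /=]
  | |- linf _ => first [ lin_leaf | rewrite linfE ]
  | |- @lin ?K ?U ?W _ =>
    first [ lin_leaf |
      match goal with
      | |- lin (fun x => sw ?s (fun a b => @?F x a b)) =>
          refine (@lin_sw K _ _ U W s F _); move=> ? ? /=
      | |- lin (fun x => sw (hdelta ?h (@?f x)) ?F) =>
          refine (@lin_delta K _ h U W F f _ _); cbv beta
      | |- lin (fun x => @?f x + @?g x) => refine (@lin_add K U W f g _ _); cbv beta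
      | |- lin (fun x => ?c *: @?f x) => refine (@lin_scale K U W c f _); cbv beta
      | |- lin (fun x => @?f x *: ?w) => refine (@lin_scalel K U W f w _); cbv beta
      | |- lin (fun x => ?c * @?f x) =>
          first [refine (@lin_mull K U _ c f _) | refine (@linf_mull K U c f _)]; cbv beta
      | |- lin (fun x => @?f x * ?c) =>
          first [refine (@lin_mulr K U _ c f _) | refine (@linf_mulr K U c f _)]; cbv beta
      | |- lin (fun x => \sum_(i <- ?r) @?F x i) =>
          refine (@lin_bigsum K U W _ r (fun i x => F x i) _); move=> ? /=
      | bF : bilin ?F |- lin (fun x => ?F (@?f x) ?b) =>
          refine (@lin_comp K U _ W (fun z => F z b) f _ _); cbv beta
      | |- lin (fun x => ?g (@?f x)) => refine (@lin_comp K U _ W g f _ _); cbv beta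
      end ]
  end.

Ltac lin_tac := intros; repeat lin_step.

(** * The antipode *)

Section Antipode.
Variables (k : fieldType) (H : algType k) (h : hopf H).
Local Notation d := (hdelta h).
Local Notation eps := (heps h).
Local Notation S := (hS h).

Lemma antipode1 : S 1 = 1.
Proof.
have := @sw_antipodel _ _ h H (fun z => z) 1 (@lin_id _ _).
rewrite sw_one; last by lin_tac.
by rewrite mulr1 counit1 scale1r.
Qed.

Lemma counit_antipode x : eps (S x) = eps x.
Proof.
have l1 : @lin _ _ k^o (fun z : H => eps (S z)) by lin_tac.
have l2 : @lin _ _ k^o eps by lin_tac.
rewrite -(sw_counitr h x l1).
have := sw_antipodel h x l2; rewrite counit1 [_ *: 1]mulr1 => <-.
by apply: (eq_sw (X := k^o)) => a b; rewrite counitM mulrC.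
Qed.

Lemma antipodeM x y : S (x * y) = S y * S x.
Proof.
(* Both sides are equal to S(x_1 y_1) x_2 y_2 S(y_3) S(x_3). *)
transitivity (sw (d x) (fun x1 x' => sw (d y) (fun y1 y' =>
  sw (d x') (fun x2 x3 => sw (d y') (fun y2 y3 =>
    S (x1 * y1) * (x2 * y2) * (S y3 * S x3)))))).
  symmetry; transitivity (sw (d x) (fun x1 x' => sw (d y) (fun y1 y' =>
    eps x' *: (eps y' *: S (x1 * y1))))); last first.
    rewrite -(sw_counitr h x (_ : lin (fun x => S (x * y)))); last by lin_tac.
    apply: eq_sw => x1 x'; rewrite sw_scale.
    by rewrite (sw_counitr h y (_ : lin (fun y => S (x1 * y)))) //; lin_tac.
  apply: eq_sw => x1 x'; apply: eq_sw => y1 y'.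
  transitivity (sw (d x') (fun x2 x3 => eps y' *: (S (x1 * y1) * (x2 * S x3)))).
    apply: eq_sw => x2 x3.
    rewrite -[x2 in RHS]mulr1.
    rewrite -(sw_antipoder h y' (_ : lin (fun z => S (x1 * y1) * (x2 * z * S x3)))).
      by apply: eq_sw => y2 y3; rewrite !mulrA.
    by lin_tac.
  rewrite (sw_antipoder h x' (_ : lin (fun z => eps y' *: (S (x1 * y1) * z)))).
    by rewrite mulr1.
  by lin_tac.
transitivity (sw (d x) (fun x' x3 => sw (d x') (fun x1 x2 =>
  sw (d y) (fun y' y3 => sw (d y') (fun y1 y2 =>
    S (x1 * y1) * (x2 * y2) * (S y3 * S x3)))))).
  rewrite [RHS](@sw_coassoc _ _ h H (fun x1 x2 x3 => sw (d y) (fun y' y3 =>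
    sw (d y') (fun y1 y2 => S (x1 * y1) * (x2 * y2) * (S y3 * S x3))))); last by lin_tac.
  apply: eq_sw => x1 x'; rewrite sw_exch; apply: eq_sw => x2 x3.
  rewrite [RHS](@sw_coassoc _ _ h H (fun y1 y2 y3 =>
    S (x1 * y1) * (x2 * y2) * (S y3 * S x3))) //; lin_tac.
transitivity (sw (d x) (fun x' x3 => eps x' *: (sw (d y) (fun y' y3 =>
  eps y' *: (S y3 * S x3))))); last first.
  rewrite (sw_counitl h x (_ : lin (fun x3 => sw (d y) (fun y' y3 => eps y' *: (S y3 * S x3))))).
    by rewrite (sw_counitl h y (_ : lin (fun y3 => S y3 * S x))) //; lin_tac.
  by lin_tac.
apply: eq_sw => x' x3; rewrite sw_exch -sw_scale; apply: eq_sw => y' y3.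
rewrite -(@sw_mul _ _ h H (fun a b => S a * b * (S y3 * S x3))); last by lin_tac.
rewrite (sw_antipodel h (x' * y') (_ : lin (fun z => z * (S y3 * S x3)))).
  by rewrite counitM mul1r scalerA.
by lin_tac.
Qed.

Lemma sw_antipode (X : lmodType k) (F : H -> H -> X) x : bilin F ->
  sw (d (S x)) F = sw (d x) (fun a b => F (S b) (S a)).
Proof.
move=> bF; have [bF1 bF2] := bF.
(* Both sides are the value of F at Delta(S(x_1)) Delta(x_2) (S(x_4) (x) S(x_3)). *)
transitivity (sw (d x) (fun x1 x' => sw (d (S x1)) (fun s1 s2 =>
  sw (d x') (fun m r => sw (d m) (fun m1 m2 => sw (d r) (fun r1 r2 =>
    F (s1 * m1 * S r2) (s2 * m2 * S r1))))))).
  rewrite -(sw_counitr h x (_ : lin (fun x => sw (d (S x)) F))); last by lin_tac.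
  apply: eq_sw => x1 x'; rewrite -sw_scale; apply: eq_sw => s1 s2.
  rewrite (@sw_coassoc _ _ h X (fun m1 m2 r => sw (d r) (fun r1 r2 =>
    F (s1 * m1 * S r2) (s2 * m2 * S r1)))); last by lin_tac.
  transitivity (sw (d x') (fun a b => sw (d b) (fun q r2 => eps q *: F (s1 * a * S r2) s2))).
    rewrite -[s1 in LHS]mulr1.
    rewrite -(sw_antipoder h x' (_ : lin (fun z => F (s1 * z) s2))); last by lin_tac.
    apply: eq_sw => a b.
    rewrite (sw_counitl h b (_ : lin (fun r2 => F (s1 * a * S r2) s2))) ?mulrA //.
    by lin_tac.
  apply: eq_sw => a b.
  rewrite -(@sw_coassoc _ _ h X (fun b r1 r2 => F (s1 * a * S r2) (s2 * b * S r1))).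
    apply: eq_sw => q r2.
    rewrite -[s2 in LHS]mulr1 -(sw_antipoder h q (_ : lin (fun z => F (s1 * a * S r2) (s2 * z)))).
      by apply: eq_sw => m2 r1; rewrite mulrA.
    by lin_tac.
  by lin_tac.
transitivity (sw (d x) (fun x'' r => sw (d x'') (fun x1 m =>
  sw (d (S x1)) (fun s1 s2 => sw (d m) (fun m1 m2 => sw (d r) (fun r1 r2 =>
    F (s1 * m1 * S r2) (s2 * m2 * S r1))))))).
  rewrite [RHS](@sw_coassoc _ _ h X (fun x1 m r =>
    sw (d (S x1)) (fun s1 s2 => sw (d m) (fun m1 m2 => sw (d r) (fun r1 r2 =>
    F (s1 * m1 * S r2) (s2 * m2 * S r1)))))).
    by apply: eq_sw => x1 x'; rewrite sw_exch.
  by lin_tac.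
transitivity (sw (d x) (fun x'' r => eps x'' *: (sw (d r) (fun a b => F (S b) (S a))))).
  apply: eq_sw => x'' r.
  transitivity (sw (d x'') (fun x1 m => sw (d (S x1 * m)) (fun u v =>
     sw (d r) (fun r1 r2 => F (u * S r2) (v * S r1))))).
    by apply: eq_sw => x1 m; rewrite sw_mul //; lin_tac.
  rewrite (sw_antipodel h x'' (_ : lin (fun z => sw (d z) (fun u v =>
     sw (d r) (fun r1 r2 => F (u * S r2) (v * S r1)))))); last by lin_tac.
  congr (_ *: _); rewrite sw_one; last by lin_tac.
  by apply: eq_sw => r1 r2; rewrite !mul1r.
by rewrite (sw_counitl h x (_ : lin (fun r => sw (d r) (fun a b => F (S b) (S a))))) //; lin_tac.
Qed.
End Antipode.

(** * Left integrals *)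

(** Stands in for choosing linearly independent first legs: these are expanded in a finite family,
    and the second legs become contractions of [s] by functionals. *)
Lemma sw_expandl (k : fieldType) (U V : lmodType k) (s : seq (U * V)) :
  exists t : seq (U * dual U), forall (X : lmodType k) (F : U -> V -> X),
    bilin F -> sw s F = \sum_(p <- t) F p.1 (sw s (fun a b => p.2 a *: b)).
Proof.
have [t tP] := finite_projection [seq p.1 | p <- s]; exists t => X F bF.
transitivity (sw s (fun a b => \sum_(p <- t) F p.1 (p.2 a *: b))).
  apply: eq_in_sw => a b abs.
  have aE : a = \sum_(p <- t) p.2 a *: p.1.
    by apply/tP/mem_span/mapP; exists (a, b).
  rewrite [a in LHS]aE (lin_sum _ _ (bF.1 b)); apply: eq_bigr => p _.
  by rewrite (linZ _ _ (bF.1 b)) (linZ _ _ (bF.2 _)).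
rewrite sw_sum; apply: eq_bigr => p _.
by rewrite (lin_sw_out _ _ (bF.2 _)).
Qed.

Section LeftIntegral.
Variables (k : fieldType) (H : algType k) (h : hopf H).
Local Notation d := (hdelta h).
Local Notation eps := (heps h).
Local Notation S := (hS h).

Definition left_integral (int : H -> k) :=
  linf int /\ forall x, sw (d x) (fun a b => int b *: a) = int x *: 1.

Variable int : H -> k.
Hypothesis int_left : left_integral int.

Let lint : linf int. Proof. exact: int_left.1. Qed.
Let lint' : @lin _ _ k^o int. Proof. exact: int_left.1. Qed.

(** On the right, invariance rewrites int(y_2 x) 1 as y_2 x_1 int(y_3 x_2), and then S(y_1) y_2
    collapses to the counit. *)
Lemma strong_invariance x y :
  sw (d x) (fun x1 x2 => int (y * x2) *: x1) =
  sw (d y) (fun y1 y2 => int (y2 * x) *: S y1).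
Proof.
symmetry; transitivity (sw (d y) (fun y1 y' => sw (d y') (fun y2 y3 =>
    sw (d x) (fun x1 x2 => int (y3 * x2) *: (S y1 * y2 * x1))))).
  apply: eq_sw => y1 y'.
  transitivity (S y1 * (int (y' * x) *: 1)); first by rewrite -scalerAr mulr1.
  rewrite -int_left.2 sw_mul; last by lin_tac.
  rewrite -sw_mull; apply: eq_sw => y2 y3.
  by rewrite -sw_mull; apply: eq_sw => x1 x2; rewrite -scalerAr mulrA.
rewrite -(@sw_coassoc _ _ h H (fun y1 y2 y3 =>
    sw (d x) (fun x1 x2 => int (y3 * x2) *: (S y1 * y2 * x1)))); last by lin_tac.
rewrite -(sw_counitl h y (_ : lin (fun y => sw (d x) (fun x1 x2 => int (y * x2) *: x1))));
  last by lin_tac.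
apply: eq_sw => y' y3.
rewrite (sw_antipodel h y' (_ : lin (fun z =>
  sw (d x) (fun x1 x2 => int (y3 * x2) *: (z * x1))))); last by lin_tac.
by congr (_ *: _); apply: eq_sw => x1 x2; rewrite mul1r.
Qed.

Hypothesis int_neq0 : exists x, int x != 0.

Lemma integral_nondegenerate x : (forall y, int (y * x) = 0) -> x = 0.
Proof.
have [x0 x0P] := int_neq0.
(* N is stable under u |-> g(u_1) u_2, hence contains the second legs of Delta(u)
   up to a change of representative, and S(u_1) u_2 shows that eps vanishes on N. *)
pose N x := forall y, int (y * x) = 0.
(* Here int(y g(u_1) u_2) is g applied to u_1 int(y u_2) = S(y_1) int(y_2 u), which is 0. *)
have Nsw u (g : H -> k) : linf g -> N u -> N (sw (d u) (fun a b => g a *: b)).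
  move=> lg Nu y; have lg' : @lin _ _ k^o g by [].
  rewrite (lin_sw_out _ _ (_ : @lin _ _ k^o (fun z => int (y * z)))); last by lin_tac.
  transitivity (g (sw (d u) (fun a b => int (y * b) *: a))); last first.
    by rewrite strong_invariance /sw big1 ?(lin0 lg') // => p _; rewrite Nu scale0r.
  rewrite (lin_sw_out _ _ lg'); apply: (eq_sw (X := k^o)) => a b.
  by rewrite (linZ _ _ lg') -scalerAr (linZ _ _ lint') /GRing.scale /= mulrC.
have Neps u : N u -> eps u = 0.
  move=> Nu; have [t tP] := sw_expandl (d u).
  have : eps u * int x0 = 0.
    transitivity (int (x0 * (eps u *: 1))).
      by rewrite -scalerAr mulr1 (linZ _ _ lint').
    rewrite -(sw_antipodel h u (@lin_id _ _)).
    rewrite tP; last by lin_tac.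
    rewrite mulr_sumr (lin_sum _ _ lint') big1 // => p _.
    by rewrite mulrA; apply: Nsw => //; exact: dual_linf.
  by move/eqP; rewrite mulf_eq0 (negPf x0P) orbF => /eqP.
(* In x = x_1 eps(x_2), expanding the first legs leaves second legs in [N], where eps vanishes. *)
move=> Nx; rewrite -(sw_counitr h x (@lin_id _ _)).
have [t ->] := sw_expandl (d x); last by lin_tac.
rewrite big1 // => p _; rewrite Neps ?scale0r //.
by apply: Nsw => //; exact: dual_linf.
Qed.

(** If int o S = 0, then w = int(x_1) x_2 satisfies int(y w) = int(S(y_1)) int(y_2 x) = 0 for all y,
    so w = 0 by nondegeneracy; but eps(w) = int(x). *)
Lemma integral_antipode_neq0 : exists x, int (S x) != 0.
Proof.
apply: contrapT => nS; have S0 x : int (S x) = 0.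
  by apply/eqP/negP=> /negP Sx; apply: nS; exists x.
have [x x0] := int_neq0; case/negP: x0.
have w0 : sw (d x) (fun a b => int a *: b) = 0.
  apply: integral_nondegenerate => y.
  rewrite (lin_sw_out _ _ (_ : @lin _ _ k^o (fun z => int (y * z)))); last by lin_tac.
  transitivity (int (sw (d x) (fun a b => int (y * b) *: a))).
    rewrite (lin_sw_out _ _ lint'); apply: (eq_sw (X := k^o)) => a b.
    by rewrite (linZ _ _ lint') -scalerAr (linZ _ _ lint') /GRing.scale /= mulrC.
  rewrite strong_invariance (lin_sw_out _ _ lint').
  by rewrite /sw big1 // => p _; rewrite (linZ _ _ lint') S0 scaler0.
rewrite -(sw_counitr h x lint'); apply/eqP.
rewrite -(lin0 (lin_counit h)) -w0.
rewrite (lin_sw_out _ _ (lin_counit h)).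
by apply: (eq_sw (X := k^o)) => a b; rewrite (linZ _ _ (lin_counit h)) /GRing.scale /= mulrC.
Qed.

(** For a functional g put u = x_1 g(x_2). If S(x) = 0, then int(y S(u)) = g(int(y S(x_1)) x_2) = 0
    for all y, hence S(u) = 0 and g(x) = eps(u) = eps(S(u)) = 0. *)
Lemma antipode_inj x : S x = 0 -> x = 0.
Proof.
move=> Sx0; apply: functionals_separate => g lg.
have lg' : @lin _ _ k^o g by [].
(* In general int(y S(x_1)) x_2 = y_1 int(y_2 S(x)). *)
have key y : sw (d x) (fun x1 x2 => int (y * S x1) *: x2) = 0.
  transitivity (sw (d y) (fun y1 y2 => int (y2 * S x) *: y1)); last first.
    by rewrite Sx0 -[RHS](sw0 _ (d y)); apply: eq_sw => a b; rewrite mulr0 (lin0 lint') scale0r.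
  transitivity (sw (d x) (fun x' x3 => sw (d x') (fun x1 x2 => sw (d y) (fun y1 y2 =>
      int (y2 * S x1) *: (y1 * S x2 * x3))))).
    apply: eq_sw => x' x3.
    transitivity ((int (y * S x') *: 1) * x3); first by rewrite -scalerAl mul1r.
    rewrite -int_left.2 sw_mul; last by lin_tac.
    transitivity (sw (d (S x')) (fun a b => sw (d y) (fun y1 y2 =>
       int (y2 * b) *: (y1 * a * x3)))).
      rewrite [RHS]sw_exch -sw_mulr; apply: eq_sw => y1 y2.
      by rewrite -sw_mulr; apply: eq_sw => a b; rewrite -scalerAl.
    by rewrite sw_antipode //; lin_tac.
  rewrite (@sw_coassoc _ _ h H (fun x1 x2 x3 => sw (d y) (fun y1 y2 =>
      int (y2 * S x1) *: (y1 * S x2 * x3)))); last by lin_tac.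
  rewrite -(sw_counitr h x (_ : lin (fun x => sw (d y) (fun y1 y2 => int (y2 * S x) *: y1))));
    last by lin_tac.
  apply: eq_sw => x1 x'.
  transitivity (sw (d x') (fun x2 x3 => sw (d y) (fun y1 y2 =>
      int (y2 * S x1) *: (y1 * (S x2 * x3))))).
    by apply: eq_sw => x2 x3; apply: eq_sw => y1 y2; rewrite mulrA.
  rewrite (sw_antipodel h x' (_ : lin (fun z => sw (d y) (fun y1 y2 =>
      int (y2 * S x1) *: (y1 * z))))); last by lin_tac.
  by congr (_ *: _); apply: eq_sw => y1 y2; rewrite mulr1.
have Sw0 : S (sw (d x) (fun a b => g b *: a)) = 0.
  apply: integral_nondegenerate => y.
  rewrite (lin_sw_out _ _ (_ : @lin _ _ k^o (fun z => int (y * S z)))); last by lin_tac.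
  rewrite -(lin0 lg') -(key y) (lin_sw_out _ _ lg').
  apply: (eq_sw (X := k^o)) => a b.
  rewrite (linZ _ _ (lin_antipode h)) -scalerAr (linZ _ _ lint') (linZ _ _ lg').
  by rewrite /GRing.scale /= mulrC.
rewrite -(sw_counitl h x lg').
have := counit_antipode h (sw (d x) (fun a b => g b *: a)).
rewrite Sw0 (lin0 (lin_counit h)).
rewrite (lin_sw_out _ _ (lin_counit h)) => E.
rewrite [RHS]E; apply: (eq_sw (X := k^o)) => a b.
by rewrite (linZ _ _ (lin_counit h)) /GRing.scale /= mulrC.
Qed.

(** Since S reverses the comultiplication, applying it to both sides gives left invariance of int at
    S(x); injectivity of S then removes it. *)
Lemma integral_antipode_right x :
  sw (d x) (fun a b => int (S a) *: b) = int (S x) *: 1.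
Proof.
apply/eqP; rewrite -subr_eq0; apply/eqP/antipode_inj.
rewrite (linB _ _ (lin_antipode h)) (linZ _ _ (lin_antipode h)) antipode1.
rewrite -int_left.2 sw_antipode; last by lin_tac.
rewrite (lin_sw_out _ _ (lin_antipode h)).
apply/eqP; rewrite subr_eq0; apply/eqP/eq_sw => a b.
by rewrite (linZ _ _ (lin_antipode h)).
Qed.
End LeftIntegral.

(** * The opposite co-opposite Hopf algebra *)

HB.instance Definition _ (k : fieldType) (H : algType k) := GRing.Lmodule.copy H^c H.
HB.instance Definition _ (k : fieldType) (H : algType k) :=
  GRing.Lmodule_isLalgebra.Build k H^c (fun a (u v : H^c) => @scalerAr k H a v u).
HB.instance Definition _ (k : fieldType) (H : algType k) :=
  GRing.Lalgebra_isAlgebra.Build k H^c (fun a (u v : H^c) => @scalerAl k H a v u).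

Section Opposite.
Variables (k : fieldType) (H : algType k) (h : hopf H).
(** Reversing the product and the coproduct together keeps S itself as antipode, without an inverse
    of S. Left integrals for this structure are right integrals on H. *)
Definition hop_delta (x : H^c) : seq (H^c * H^c) := [seq (p.2, p.1) | p <- hdelta h x].

Lemma hop_ax : @is_hopf k H^c hop_delta (heps h) (hS h).
Proof.
split.
- move=> a x y X F bF; rewrite big_cat !big_map /=.
  have bF' : @bilin k H H X (fun u v => F v u) by split=> u; [apply: bF.2|apply: bF.1].
  have := @lin_delta _ _ h H X (fun u v => F v u) (fun x => x) bF' (@lin_id _ _) a x y.
  rewrite /sw => ->; congr (_ + _); rewrite scaler_sumr; apply: eq_bigr => p _.
  by rewrite (linZ a _ (bF.1 p.1)).
- move=> x X F [tF1 [tF2 tF3]].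
  rewrite !big_allpairs_dep !big_map /=.
  under eq_bigr do rewrite big_map /=.
  under [RHS]eq_bigr do rewrite big_map /=.
  apply: esym; apply: (@sw_coassoc _ _ h X (fun a b c => F c b a) x).
  by split; [move=> ? ?; exact: tF3|split => ? ?; [exact: tF2|exact: tF1]].
- split; first exact: (linf_counit h).
  move=> x; rewrite !big_map /=; split.
    exact: (sw_counitr h x (@lin_id _ _)).
  exact: (sw_counitl h x (@lin_id _ _)).
- split.
  + move=> a b X F bF.
    have bF' : @bilin k H H X (fun u v => F v u) by split=> u; [apply: bF.2|apply: bF.1].
    rewrite big_allpairs_dep !big_map /=.
    under [RHS]eq_bigr do rewrite big_map /=.
    have := @sw_mul _ _ h X (fun u v => F v u) b a bF'.
    by rewrite sw_exch /sw => ->.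
  + move=> X F bF; rewrite big_map big_seq1 /=.
    have bF' : @bilin k H H X (fun u v => F v u) by split=> u; [apply: bF.2|apply: bF.1].
    exact: (@sw_one _ _ h X (fun u v => F v u) bF').
  + by move=> a b; rewrite mulrC; exact: (counitM h).
  + exact: (counit1 h).
- split; first exact: (lin_antipode h).
  move=> x; rewrite !big_map; split.
    exact: (sw_antipoder h x (@lin_id _ _)).
  exact: (sw_antipodel h x (@lin_id _ _)).
Qed.

Definition hop : hopf H^c := Hopf hop_ax.

Lemma sw_hop (X : lmodType k) (F : H -> H -> X) x :
  @sw k H^c H^c X (hdelta hop x) F = sw (hdelta h x) (fun a b => F b a).
Proof. exact: sw_swap. Qed.
End Opposite.

Lemma co_frobeniusP (k : fieldType) (H : algType k) (h : hopf H) :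
  co_frobenius h <-> exists2 int, left_integral h int & exists x, int x != 0.
Proof.
split=> [[int [li nz inv]]|[int [li inv] nz]]; exists int => //.
Qed.

Lemma co_frobenius_hop (k : fieldType) (H : algType k) (h : hopf H) :
  co_frobenius h -> co_frobenius (hop h).
Proof.
case/co_frobeniusP=> int il nz; apply/co_frobeniusP; exists (fun x => int (hS h x)).
  split=> [a x y|x]; first by rewrite (lin_antipode h) il.1.
  by rewrite sw_hop; exact: integral_antipode_right il nz x.
exact: integral_antipode_neq0 il nz.
Qed.

(** Reversing twice gives back the comultiplication of [h]. *)
Lemma co_frobenius_of_hop (k : fieldType) (H : algType k) (h : hopf H) :
  co_frobenius (hop h) -> co_frobenius h.
Proof.
move/co_frobenius_hop/co_frobeniusP=> [int [li inv] nz]; apply/co_frobeniusP.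
by exists int => //; split=> // x; have := inv x; rewrite !sw_hop.
Qed.

(** * Rational functionals *)

(** Classical equality on functionals gives a meaning to membership in lists that carry them. *)
HB.instance Definition _ (k : fieldType) (V : lmodType k) := gen_eqMixin (dual V).

Section RationalFunctional.
Variables (k : fieldType) (H : algType k) (h : hopf H).
Local Notation d := (hdelta h).
Local Notation eps := (heps h).
Local Notation S := (hS h).

(** The left action of the convolution algebra of functionals on H. *)
Definition contract (g : H -> k) (z : H) : H := sw (d z) (fun a b => g b *: a).

Lemma lin_contract g : linf g -> lin (contract g).
Proof. by move=> lg; rewrite /contract; lin_tac. Qed.

Lemma sw_contract (X : lmodType k) (F : H -> H -> X) g z : linf g -> bilin F ->
  sw (d (contract g z)) F = sw (d z) (fun a b => F a (contract g b)).
Proof.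
move=> lg bF.
rewrite /contract (lin_sw_out _ _ (_ : lin (fun x => sw (d x) F))); last by lin_tac.
transitivity (sw (d z) (fun t c => sw (d t) (fun a b => g c *: F a b))).
  apply: eq_sw => t c; rewrite sw_scale.
  by apply: (linZ _ _ (_ : lin (fun x => sw (d x) F))); lin_tac.
rewrite (@sw_coassoc _ _ h X (fun a b c => g c *: F a b)); last by lin_tac.
apply: eq_sw => a b; rewrite (lin_sw_out _ _ (bF.2 a)).
by apply: eq_sw => ? ?; rewrite (linZ _ _ (bF.2 a)).
Qed.

(** The list [s] records the coaction f_0 (x) f_1 of the rational functional f: the [p.2] are the
    legs f_0, the [p.1] the legs f_1. *)
Variables (f : H -> k) (s : seq (H * dual H)).
Hypothesis lf : linf f.
Hypothesis f_rat : forall a,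
  sw (d a) (fun a1 a2 => f a2 *: a1) = \sum_(p <- s) p.2 a *: p.1.

(** Coassociativity of the coaction recorded in [s], evaluated at a: both sides are G(a_1, a_2)
    f(a_3). *)
Lemma rational_coaction (X : lmodType k) (G : H -> H -> X) a : bilin G ->
  \sum_(p <- s) sw (d a) (fun a1 a2 => p.2 a2 *: G a1 p.1) =
  \sum_(p <- s) p.2 a *: sw (d p.1) G.
Proof.
move=> bG; have lG : lin (fun x => sw (d x) G) by lin_tac.
transitivity (sw (d (\sum_(p <- s) p.2 a *: p.1)) G); last first.
  by rewrite (lin_sum _ _ lG); apply: eq_bigr => p _; rewrite (linZ _ _ lG).
rewrite -f_rat [RHS](lin_sw_out _ _ lG) -sw_sum.
transitivity (sw (d a) (fun a1 c => sw (d c) (fun a2 a3 => f a3 *: G a1 a2))).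
  apply: eq_sw => a1 c.
  transitivity (G a1 (\sum_(p <- s) p.2 c *: p.1)).
    by rewrite (lin_sum _ _ (bG.2 a1)); apply: eq_bigr => p _; rewrite (linZ _ _ (bG.2 a1)).
  rewrite -f_rat (lin_sw_out _ _ (bG.2 a1)).
  by apply: eq_sw => a2 a3; rewrite (linZ _ _ (bG.2 a1)).
rewrite -(@sw_coassoc _ _ h X (fun a1 a2 a3 => f a3 *: G a1 a2)); last by lin_tac.
by apply: eq_sw => c a3; rewrite sw_scale (linZ _ _ lG).
Qed.

(** One finite family serves all p in [s]. It replaces the second legs of the [p.1] by vectors
    independent of p, so that identities for f_0 at a fixed argument apply. *)
Lemma projection_second_legs : exists t : seq (H * dual H),
  forall (X : lmodType k) (K : H * dual H -> H -> H -> X),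
    (forall p a, lin (K p a)) ->
    \sum_(p <- s) sw (d p.1) (K p) =
    \sum_(q <- t) \sum_(p <- s) sw (d p.1) (fun a b => q.2 b *: K p a q.1).
Proof.
have [t tP] := finite_projection (flatten [seq [seq q.2 | q <- d p.1] | p <- s]).
exists t => X K lK; rewrite exchange_big /= !big_seq; apply: eq_bigr => p ps.
rewrite -sw_sum; apply: eq_in_sw => a b abp.
have bE : b = \sum_(q <- t) q.2 b *: q.1.
  apply/tP/mem_span/flattenP; exists [seq q.2 | q <- d p.1]; first by apply/mapP; exists p.
  by apply/mapP; exists (a, b).
rewrite {1}bE (lin_sum _ _ (lK p a)); apply: eq_bigr => q _.
by rewrite (linZ _ _ (lK p a)).
Qed.

(* Here the argument Y u of the functionals is allowed to depend on p.1. *)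
Lemma rational_coaction_dep (X : lmodType k) (G : H -> H -> X) (Y : H -> H) :
  bilin G -> lin Y ->
  \sum_(p <- s) sw (d p.1) (fun z u => sw (d (Y u)) (fun a1 a2 => p.2 a2 *: G a1 z)) =
  \sum_(p <- s) sw (d p.1) (fun z u => p.2 (Y u) *: sw (d z) G).
Proof.
move=> bG lY; have lG : lin (fun x => sw (d x) G) by lin_tac.
have [t tP] := projection_second_legs.
rewrite tP; last by lin_tac.
rewrite [RHS]tP; last by lin_tac.
apply: eq_bigr => q _.
transitivity (\sum_(p <- s) sw (d (Y q.1)) (fun a1 a2 => p.2 a2 *: G a1 (contract q.2 p.1))).
  apply: eq_bigr => p _; under eq_sw => a b do rewrite -sw_scale.
  rewrite sw_exch; apply: eq_sw => a1 a2.
  rewrite /contract (lin_sw_out _ _ (bG.2 a1)) -sw_scale; apply: eq_sw => z u.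
  by rewrite (linZ _ _ (bG.2 a1)) !scalerA mulrC.
rewrite (@rational_coaction X (fun a b => G a (contract q.2 b))); last first.
  by have lc := lin_contract (dual_linf q.2); lin_tac.
apply: eq_bigr => p _.
rewrite -sw_contract //; last exact: dual_linf.
rewrite (lin_sw_out _ _ lG) -sw_scale; apply: eq_sw => a b.
by rewrite (linZ _ _ lG) !scalerA mulrC.
Qed.

(* For the Hopf module structure (f h)(a) = f(a S(h)) on rational functionals, this
   is the projection f_0 S(f_1) to the coinvariants, applied to g * f. *)
Definition rational_integral (g : H -> k) (a : H) : k :=
  \sum_(p <- s) p.2 (a * S (S (contract g p.1))).

Lemma rational_integral_left g : linf g -> left_integral h (rational_integral g).
Proof.
move=> lg; have lc := lin_contract lg.
(* On the right the first leg is a_1 S(S(z_2)) S(z_1) = a_1 S(z_1 S(z_2)), which collapses. The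
   argument of psi thus becomes a leg of a single comultiplication. *)
have untwist (psi : dual H) a z :
    sw (d a) (fun a1 a2 => psi (a2 * S (S z)) *: a1) =
    sw (d z) (fun z1 z2 => sw (d (a * S (S z2))) (fun x1 x2 => psi x2 *: (x1 * S z1))).
  symmetry; transitivity (sw (d z) (fun z1 z' => sw (d z') (fun z2 z3 =>
      sw (d a) (fun a1 a2 => psi (a2 * S (S z3)) *: (a1 * S (z1 * S z2)))))).
    apply: eq_sw => z1 z'; rewrite sw_mul; last by lin_tac.
    rewrite sw_exch sw_antipode; last by lin_tac.
    rewrite sw_antipode; last by lin_tac.
    apply: eq_sw => z2 z3; apply: eq_sw => a1 a2.
    by rewrite antipodeM mulrA.
  rewrite -(@sw_coassoc _ _ h H (fun z1 z2 z3 => sw (d a) (fun a1 a2 =>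
    psi (a2 * S (S z3)) *: (a1 * S (z1 * S z2))))); last by lin_tac.
  rewrite -(sw_counitl h z (_ : lin (fun z => sw (d a) (fun a1 a2 => psi (a2 * S (S z)) *: a1))));
    last by lin_tac.
  apply: eq_sw => z' z3.
  rewrite (sw_antipoder h z' (_ : lin (fun u => sw (d a) (fun a1 a2 =>
    psi (a2 * S (S z3)) *: (a1 * S u))))); last by lin_tac.
  by congr (_ *: _); apply: eq_sw => a1 a2; rewrite antipode1 mulr1.
split; first by rewrite /rational_integral; lin_tac.
move=> a; transitivity (\sum_(p <- s) sw (d a) (fun a1 a2 =>
    p.2 (a2 * S (S (contract g p.1))) *: a1)).
  by rewrite -sw_sum; apply: eq_sw => a1 a2; rewrite scaler_suml.
pose Y u := a * S (S (contract g u)).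
transitivity (\sum_(p <- s) sw (d p.1) (fun z u =>
    sw (d (Y u)) (fun x1 x2 => p.2 x2 *: (x1 * S z)))).
  apply: eq_bigr => p _; rewrite untwist sw_contract //; lin_tac.
(* Coassociativity brings the two factors together as z_1 S(z_2), which is a counit. *)
rewrite (@rational_coaction_dep H (fun x z => x * S z) Y) /Y; try by lin_tac.
rewrite scaler_suml; apply: eq_bigr => p _.
rewrite -(sw_counitl h p.1 (_ : lin (fun u => p.2 (a * S (S (contract g u))) *: (1 : H))));
  last by lin_tac.
apply: eq_sw => z u; rewrite (sw_antipoder h z (@lin_id _ _)).
by rewrite !scalerA mulrC.
Qed.

(** The identity f = f_0 S(f_1) f_2 reads f(x0) = f_0(x0 S(f_2) S(S(f_1))). Expanding the legs f_2
    by functionals turns this into a sum of values of [rational_integral], so these cannot all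
    vanish. *)
Lemma co_frobenius_of_rational x0 : f x0 != 0 -> co_frobenius h.
Proof.
move=> fx0; apply: contrapT => ncF.
have lam0 g a : linf g -> rational_integral g a = 0.
  move=> lg; apply/eqP/negP=> /negP nz; apply/ncF/co_frobeniusP.
  exists (rational_integral g); first exact: rational_integral_left.
  by exists a.
case/negP: fx0; apply/eqP.
have leps : @lin _ _ k^o eps by lin_tac.
have lf' : @lin _ _ k^o f by [].
transitivity (eps (sw (d x0) (fun a1 a2 => f a2 *: a1))).
  rewrite (lin_sw_out _ _ leps) -(sw_counitl h x0 lf').
  by apply: (eq_sw (X := k^o)) => a b; rewrite (linZ _ _ leps) /GRing.scale /= mulrC.
rewrite f_rat (lin_sum _ _ leps).
transitivity (\sum_(p <- s) sw (d p.1) (fun z1 z2 =>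
  p.2 (x0 * S z2 * S (S z1)) : k^o)).
  apply: eq_bigr => p _; rewrite (linZ _ _ leps).
  transitivity (eps p.1 *: (p.2 (x0 * S 1) : k^o)).
    by rewrite antipode1 mulr1 /GRing.scale /= mulrC.
  rewrite -(sw_antipodel h p.1 (_ : @lin _ _ k^o (fun u => p.2 (x0 * S u)))); last by lin_tac.
  by apply: (eq_sw (X := k^o)) => z1 z2; rewrite antipodeM mulrA.
have [t ->] := projection_second_legs; last by lin_tac.
rewrite big1 // => q _.
rewrite -[RHS](lam0 q.2 (x0 * S q.1) (dual_linf q.2)); apply: eq_bigr => p _.
rewrite /contract.
rewrite (lin_sw_out _ _ (_ : @lin _ _ k^o (fun u => p.2 (x0 * S q.1 * S (S u))))); last by lin_tac.
apply: (eq_sw (X := k^o)) => a b.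
by rewrite (linZ _ _ (_ : @lin _ _ k^o (fun u => p.2 (x0 * S q.1 * S (S u))))) //; lin_tac.
Qed.
End RationalFunctional.

(** * Quotients by subspaces *)

Local Open Scope quotient_scope.
Section Quotient.
Variables (k : fieldType) (V : lmodType k) (P : V -> Prop) (sP : is_subspace P).

(* The dummy argument carries the proof from which the instance below is inferred. *)
Definition subspace_pred of is_subspace P : {pred V} := fun x => `[< P x >].

Fact subspace_zmod_closed : zmod_closed (subspace_pred sP).
Proof.
split; first by apply/asboolP; exact: subspace0 sP.
move=> x y /asboolP Px /asboolP Py; apply/asboolP.
by rewrite -[- y]scaleN1r addrC; apply: (subspaceL sP).
Qed.
HB.instance Definition _ := GRing.isZmodClosed.Build V (subspace_pred sP) subspace_zmod_closed.

Local Notation Q := (Quotient.quot (subspace_pred sP)).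

Definition quot_scale (a : k) (u : Q) : Q := \pi_Q (a *: repr u).

Lemma pi_scale a x : quot_scale a (\pi_Q x) = \pi_Q (a *: x).
Proof.
apply/eqP; rewrite /quot_scale -Quotient.idealrBE; apply/asboolP.
rewrite -scalerBr; apply: (subspaceZ _ sP).
have : repr (\pi_Q x) - x \in subspace_pred sP by rewrite Quotient.idealrBE reprK.
by move/asboolP.
Qed.

Fact quot_scalerA a b u : quot_scale a (quot_scale b u) = quot_scale (a * b) u.
Proof. by rewrite -[u]reprK (pi_scale b) !pi_scale scalerA. Qed.

Fact quot_scale1r : left_id 1 quot_scale.
Proof. by move=> u; rewrite -[u]reprK !pi_scale scale1r. Qed.

Fact quot_scalerDr : right_distributive quot_scale +%R.
Proof. by move=> a u v; rewrite -[u]reprK -[v]reprK -raddfD !pi_scale scalerDr raddfD. Qed.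

Fact quot_scalerDl u : {morph quot_scale^~ u : a b / a + b}.
Proof. by move=> a b; rewrite -[u]reprK !pi_scale scalerDl raddfD. Qed.

HB.instance Definition _ := GRing.Zmodule_isLmodule.Build k Q
  quot_scalerA quot_scale1r quot_scalerDr quot_scalerDl.

(** The section [r] is a mere choice of representatives and is not claimed to be linear. *)
Lemma quotient_exists : exists (W : lmodType k) (q : V -> W) (r : W -> V),
  [/\ lin q, cancel r q & forall x, q x = 0 <-> P x].
Proof.
exists (Q : lmodType k), \pi_Q, repr; split.
- by move=> a x y; rewrite raddfD /= -pi_scale.
- exact: reprK.
- move=> x; have pi0 : (0 : Q) = \pi_Q 0 by rewrite raddf0.
  have E : (x - 0 \in subspace_pred sP) = (\pi_Q x == \pi_Q 0) := Quotient.idealrBE _ x 0.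
  rewrite subr0 in E; split=> [x0|Px].
    by apply/asboolP; rewrite -[asbool _]/(x \in subspace_pred sP) E; apply/eqP/(etrans x0 pi0).
  by apply: (etrans _ (esym pi0)); apply/eqP; rewrite -E; apply/asboolP.
Qed.
End Quotient.

(** * Sub-Hopf algebras and extensions *)

Section HopfMaps.
Variable k : fieldType.

Lemma sw_hopf_map (H1 H2 : algType k) (h1 : hopf H1) (h2 : hopf H2) (f : H1 -> H2)
    (X : lmodType k) (F : H2 -> H2 -> X) x :
  is_hopf_map h1 h2 f -> bilin F ->
  sw (hdelta h2 (f x)) F = sw (hdelta h1 x) (fun a b => F (f a) (f b)).
Proof.
by move=> [_ _ _ fd _] bF; have := fd x X F bF; rewrite big_map.
Qed.

(** Only the sums lie in the image of [iota], not each [p.1]. Evaluating at v1 with phi(v1) = 1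
    expresses x by some iota(z) and the other vectors; substituting this shortens the list. *)
Lemma finite_rank_pullback (A B V : lmodType k) (iota : A -> B) (s : seq (B * dual V)) :
  lin iota -> (forall v, exists a, \sum_(p <- s) p.2 v *: p.1 = iota a) ->
  exists t : seq (A * dual V), forall v,
    \sum_(p <- s) p.2 v *: p.1 = iota (\sum_(p <- t) p.2 v *: p.1).
Proof.
move=> li; have [n] := ubnP (size s); elim: n s => // n IH [|[x phi] s] /= sn sP.
  by exists [::] => v; rewrite !big_nil (lin0 li).
have lphi : @lin _ _ k^o phi by exact: dual_linf.
have [[v0 v0P]|phi0] := pselect (exists v, phi v != 0); last first.
  have phi0' v : phi v = 0.
    by apply/eqP/negP=> /negP pv; apply: phi0; exists v.
  have [|v|t tP] := IH s; first by [].
    by have [a aE] := sP v; exists a; rewrite -aE big_cons /= phi0' scale0r add0r.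
  by exists t => v; rewrite big_cons /= phi0' scale0r add0r.
pose v1 := (phi v0)^-1 *: v0.
have phi1 : phi v1 = 1 by rewrite (linZ _ _ lphi) /GRing.scale /= mulVf.
have [z zP] := sP v1; move: zP; rewrite big_cons /= phi1 scale1r => zP.
have lp (p : B * dual V) : linf (fun v => p.2 v - p.2 v1 * phi v).
  move=> a u w; rewrite (dual_linf p.2) (dual_linf phi).
  by rewrite mulrDr opprD addrACA mulrBr mulrCA.
have sumE v : \sum_(p <- [seq (p.1, Dual (lp p)) | p <- s]) p.2 v *: p.1 =
    \sum_(p <- (x, phi) :: s) p.2 v *: p.1 - phi v *: iota z.
  rewrite big_map big_cons /= -zP scalerDr opprD addrACA subrr add0r.
  rewrite scaler_sumr -sumrB; apply: eq_bigr => p _.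
  by rewrite scalerBl scalerA mulrC.
have [|v|t tP] := IH [seq (p.1, Dual (lp p)) | p <- s]; first by rewrite size_map.
  rewrite sumE; have [a ->] := sP v; exists (a - phi v *: z).
  by rewrite (linB _ _ li) (linZ _ _ li).
exists ((z, phi) :: t) => v; rewrite [in RHS]big_cons /= (linD _ _ li) (linZ _ _ li).
by rewrite -tP sumE addrC subrK.
Qed.

Lemma co_frobenius_sub (A B : algType k) (hA : hopf A) (hB : hopf B) (iota : A -> B) :
  is_hopf_map hA hB iota -> injective iota -> co_frobenius hB -> co_frobenius hA.
Proof.
move=> hi inj /co_frobeniusP[int il [b b0]]; have [li i1 _ _ _] := hi.
have lint : @lin _ _ k^o int := il.1.
have lf (c : B) : linf (fun a => int (c * iota a)) by lin_tac.
(* By strong invariance the left side is S(b_1) int(b_2 iota(a)), so it stays in the span of the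
   S(b_1). *)
have rat a : sw (hdelta hA a) (fun a1 a2 => int (b * iota a2) *: iota a1) =
    \sum_(p <- [seq (hS hB q.1, Dual (lf q.2)) | q <- hdelta hB b]) p.2 a *: p.1.
  rewrite big_map /= -(@sw_hopf_map _ _ hA hB iota _ (fun x y => int (b * y) *: x)) //.
    exact: (strong_invariance il).
  by lin_tac.
have [v|t tP] := finite_rank_pullback li (s := [seq (hS hB q.1, Dual (lf q.2)) | q <- hdelta hB b]).
  exists (sw (hdelta hA v) (fun a1 a2 => int (b * iota a2) *: a1)).
  by rewrite -rat (lin_sw_out _ _ li); apply: eq_sw => x y; rewrite (linZ _ _ li).
apply: (@co_frobenius_of_rational _ _ hA (fun a => int (b * iota a)) t _ _ 1).
- exact: lf.
- move=> a; apply: inj; rewrite -tP -rat (lin_sw_out _ _ li).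
  by apply: eq_sw => x y; rewrite (linZ _ _ li).
- by rewrite i1 mulr1.
Qed.

Lemma co_frobenius_extension (A B C : algType k) (hA : hopf A) (hB : hopf B) (hC : hopf C)
    (iota : A -> B) (pi : B -> C) :
  exact_hopf_seq hA hB hC iota pi ->
  co_frobenius hA -> co_frobenius hC -> co_frobenius hB.
Proof.
move=> [[hi hp] inj surj kerp coinv] /co_frobeniusP[intA ilA [a0 a0P]].
move=> /co_frobeniusP[intC ilC [c0 c0P]].
have [li i1 iM _ iE] := hi; have [lp p1 pM _ pE] := hp.
have lA : @lin _ _ k^o intA := ilA.1.
have lC : @lin _ _ k^o intC := ilC.1.
pose E b := sw (hdelta hB b) (fun x y => intC (pi y) *: x).
have lE : lin E by rewrite /E; lin_tac.
have EdE (X : lmodType k) (F : B -> B -> X) b : bilin F ->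
    sw (hdelta hB (E b)) F = sw (hdelta hB b) (fun x y => F x (E y)).
  move=> bF; apply: (@sw_contract _ _ hB X F (fun y => intC (pi y))) => //.
  by lin_tac.
have Eim b : exists a, E b = iota a.
  apply/coinv => X F bF; rewrite big_map big_seq1 /=.
  rewrite -[LHS]/(sw (hdelta hB (E b)) (fun x y => F x (pi y))).
  rewrite EdE; last by lin_tac.
  rewrite /E (lin_sw_out _ _ (bF.1 1)); apply: eq_sw => x y.
  transitivity (F x (intC (pi y) *: 1)); last by rewrite (linZ _ _ (bF.1 _)) (linZ _ _ (bF.2 _)).
  congr (F x _); rewrite -ilC.2.
  rewrite (@sw_hopf_map _ _ hB hC pi _ (fun x y => intC y *: x)) //; last by lin_tac.
  by rewrite (lin_sw_out _ _ lp); apply: eq_sw => u v; rewrite (linZ _ _ lp).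
have [e eP] := choice Eim.
have le : lin e by move=> a x y; apply: inj; rewrite -eP li -!eP lE.
pose int b := intA (e b).
have lint : @lin _ _ k^o int by rewrite /int; lin_tac.
(* This is e(b)_1 (x) e(b)_2 = b_1 (x) e(b_2) in B (x) A. It is known after applying [iota] to the
   second legs; as these are finitely many, functionals recover each z from iota(z), and F factors
   through G. *)
have de (X : lmodType k) (F : B -> A -> X) b : bilin F ->
    sw (hdelta hA (e b)) (fun x y => F (iota x) y) = sw (hdelta hB b) (fun x y => F x (e y)).
  move=> bF; pose zs := [seq q.2 | q <- hdelta hA (e b)] ++ [seq e q.2 | q <- hdelta hB b].
  have [t tP] := finite_projection_map iota zs.
  have zE z : z \in zs -> z = \sum_(p <- t) p.2 (iota z) *: p.1.
    move=> zzs; apply: inj; rewrite (lin_sum _ _ li) {1}(tP (iota z)).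
      by apply: eq_bigr => p _; rewrite (linZ _ _ li).
    exact/mem_span/map_f.
  pose G u w := \sum_(p <- t) p.2 w *: F u p.1.
  have bG : bilin G by rewrite /G; lin_tac.
  have FG u z : z \in zs -> F u z = G u (iota z).
    move=> zzs; rewrite {1}(zE _ zzs) (lin_sum _ _ (bF.2 u)).
    by apply: eq_bigr => p _; rewrite (linZ _ _ (bF.2 u)).
  transitivity (sw (hdelta hA (e b)) (fun x y => G (iota x) (iota y))).
    apply: eq_in_sw => x y xy; apply: FG; rewrite mem_cat; apply/orP; left.
    by apply/mapP; exists (x, y).
  rewrite -(sw_hopf_map _ hi) // -eP EdE //; apply: eq_in_sw => x y xy.
  rewrite eP; apply/esym/FG; rewrite mem_cat; apply/orP; right.
  by apply/mapP; exists (x, y).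
have pii a : pi (iota a) = heps hA a *: 1.
  apply/eqP; rewrite -subr_eq0 -p1 -(linZ _ _ lp) -(linB _ _ lp); apply/eqP.
  have [_ ->] := kerp (iota a - heps hA a *: 1).
    by [].
  exists [:: (1, a - heps hA a *: 1)]; split.
    move=> p; rewrite inE => /eqP ->; rewrite (linB _ _ (lin_counit hA)).
    by rewrite (linZ _ _ (lin_counit hA)) counit1 [_ *: 1]mulr1 subrr.
  by rewrite big_seq1 mul1r (linB _ _ li) (linZ _ _ li) i1.
have eM a b : e (iota a * b) = a * e b.
  apply: inj; rewrite iM -!eP /E sw_mul; last by lin_tac.
  rewrite (sw_hopf_map _ hi); last by lin_tac.
  rewrite -(sw_counitr hA a (_ : lin iota)) // -sw_mulr; apply: eq_sw => a1 a2.
  rewrite -sw_mull; apply: eq_sw => x y.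
  by rewrite pM pii -scalerAl mul1r (linZ _ _ lC) -scalerAr -scalerAl scalerA mulrC.
apply/co_frobeniusP; exists int.
  split=> // b; rewrite -(de _ (fun x y => intA y *: x)); last by lin_tac.
  transitivity (iota (intA (e b) *: 1)); last by rewrite (linZ _ _ li) i1.
  rewrite -ilA.2 (lin_sw_out _ _ li).
  by apply: eq_sw => x y; rewrite (linZ _ _ li).
apply: contrapT => nint.
have int0 b : int b = 0 by apply/eqP/negP=> /negP bP; apply: nint; exists b.
(* If int = 0, left A-linearity and nondegeneracy of [intA] give e(b0) = 0, whereas eps(E(b0)) =
   intC(c0). *)
have [b0 b0E] := surj c0; case/negP: c0P.
have e0 : e b0 = 0.
  apply: (integral_nondegenerate ilA); first by exists a0.
  by move=> a; rewrite -eM; exact: int0.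
have leps : @lin _ _ k^o (heps hB) := linf_counit hB.
have : heps hB (E b0) = intC c0.
  rewrite /E (lin_sw_out _ _ leps) -b0E.
  rewrite -(sw_counitl hB b0 (_ : @lin _ _ k^o (fun b => intC (pi b)))); last by lin_tac.
  by apply: (eq_sw (X := k^o)) => x y; rewrite (linZ _ _ leps) /GRing.scale /= mulrC.
by rewrite eP e0 (lin0 li) (lin0 leps) => <-.
Qed.
End HopfMaps.

(** * Coflat quotients *)

Section Comodules.
Variables (k : fieldType) (C : algType k) (hC : hopf C).
Local Notation d := (hdelta hC).

Definition single n (i : 'I_n) (c : C) : {ffun 'I_n -> C} :=
  [ffun j => if j == i then c else 0].

Lemma lin_single n (i : 'I_n) : lin (single i).
Proof.
move=> a x y; apply/ffunP=> j; rewrite !ffunE.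
by case: ifP; rewrite // scaler0 addr0.
Qed.

Lemma lin_ffun_eval n (i : 'I_n) : lin (fun y : {ffun 'I_n -> C} => y i).
Proof. by move=> a x y; rewrite !ffunE. Qed.

Lemma sum_single n (y : {ffun 'I_n -> C}) : \sum_i single i (y i) = y.
Proof.
apply/ffunP=> j; rewrite sum_ffunE (bigD1 j) //= ffunE eqxx big1 ?addr0 // => i ij.
by rewrite ffunE eq_sym (negPf ij).
Qed.

(** The direct sum of n copies of the regular left comodule. *)
Definition cofree_coaction n (y : {ffun 'I_n -> C}) : seq (C * {ffun 'I_n -> C}) :=
  [seq (q.1, single i q.2) | i <- index_enum 'I_n, q <- d (y i)].

Lemma sw_cofree n (X : lmodType k) (F : C -> {ffun 'I_n -> C} -> X) y :
  sw (cofree_coaction y) F = \sum_i sw (d (y i)) (fun a b => F a (single i b)).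
Proof. by rewrite /sw /cofree_coaction big_allpairs_dep. Qed.

Lemma sw_cofree_single n (X : lmodType k) (F : C -> {ffun 'I_n -> C} -> X) i c : bilin F ->
  sw (cofree_coaction (single i c)) F = sw (d c) (fun a b => F a (single i b)).
Proof.
move=> bF; have ls := @lin_single n.
rewrite sw_cofree (bigD1 i) //= ffunE eqxx big1 ?addr0 // => j ji.
rewrite ffunE (negPf ji).
by apply: (lin0 (_ : lin (fun c => sw (d c) (fun a b => F a (single j b))))); lin_tac.
Qed.

Lemma cofree_comodule n : is_lcomod hC (@cofree_coaction n).
Proof.
have ls := @lin_single n; split.
- move=> a x y X F bF; rewrite big_cat big_map /=.
  rewrite -[LHS]/(sw (cofree_coaction (a *: x + y)) F) -[X in _ = _ + X]/(sw (cofree_coaction y) F).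
  transitivity (a *: sw (cofree_coaction x) F + sw (cofree_coaction y) F).
    rewrite !sw_cofree scaler_sumr -big_split; apply: eq_bigr => i _ /=.
    rewrite !ffunE.
    by apply: (_ : lin (fun c => sw (d c) (fun a b => F a (single i b)))); lin_tac.
  congr (_ + _); rewrite -sw_scale; apply: eq_bigr => p _.
  by rewrite (linZ _ _ (bF.2 _)).
- move=> m X F [tF1 [tF2 tF3]]; rewrite !big_allpairs_dep /=.
  apply: eq_bigr => i _.
  rewrite -[LHS]/(sw (d (m i)) (fun a c => sw (d a) (fun a' b => F a' b (single i c)))).
  rewrite -[RHS]/(sw (d (m i)) (fun a b => sw (cofree_coaction (single i b)) (F a))).
  rewrite (@sw_coassoc _ _ hC X (fun a b c => F a b (single i c))); last first.
    split; first by move=> y z; apply: tF1.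
    split; first by move=> x z; apply: tF2.
    by move=> x y; apply: (lin_comp (tF3 x y)).
  by apply: eq_sw => a b; rewrite -(@sw_cofree_single _ _ (F a)).
- move=> m; rewrite -[LHS]/(sw (cofree_coaction m) (fun a b => heps hC a *: b)).
  rewrite sw_cofree -[RHS]sum_single; apply: eq_bigr => i _.
  by rewrite (sw_counitl hC (m i) (ls i)).
Qed.

Lemma regular_comodule : is_lcomod hC d.
Proof.
split.
- move=> a x y X F bF; rewrite big_cat big_map /=.
  have := @lin_delta _ _ hC C X F (fun x => x) bF (@lin_id _ _) a x y.
  rewrite /sw => ->; congr (_ + _); rewrite scaler_sumr; apply: eq_bigr => p _.
  by rewrite (linZ _ _ (bF.2 _)).
- move=> x X F tF; rewrite !big_allpairs_dep /=.
  exact: (@sw_coassoc _ _ hC X F x).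
- by move=> x; apply: (sw_counitl hC x (@lin_id _ _)).
Qed.

(** The last hypothesis says that ker q is a subcomodule, which makes the coaction independent of
    the representatives chosen by [r]. *)
Lemma quotient_comodule (W : lmodType k) (q : C -> W) (r : W -> C) :
  lin q -> cancel r q ->
  (forall x (X : lmodType k) (F : C -> W -> X), bilin F -> q x = 0 ->
     sw (d x) (fun a b => F a (q b)) = 0) ->
  is_lcomod hC (fun u => [seq (p.1, q p.2) | p <- d (r u)]) /\
  is_comod_map d (fun u => [seq (p.1, q p.2) | p <- d (r u)]) q.
Proof.
move=> lq rK q0.
have swq (X : lmodType k) (F : C -> W -> X) x : bilin F ->
    sw (d (r (q x))) (fun a b => F a (q b)) = sw (d x) (fun a b => F a (q b)).
  move=> bF; apply/eqP; rewrite -subr_eq0; apply/eqP.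
  rewrite -(linB _ _ (_ : lin (fun x => sw (d x) (fun a b => F a (q b))))); last by lin_tac.
  by apply: q0 => //; rewrite (linB _ _ lq) rK subrr.
split; last first.
  by split=> // x X F bF; rewrite !big_map; apply: swq.
split.
- move=> a u v X F bF; rewrite big_cat !big_map /=.
  have l1 : lin (fun x => sw (d x) (fun a b => F a (q b))) by lin_tac.
  have := l1 a (r u) (r v); rewrite -swq // lq !rK => E.
  apply: (etrans E); congr (_ + _); rewrite -sw_scale; apply: eq_bigr => p _.
  by rewrite (linZ _ _ (bF.2 _)).
- move=> u X F [tF1 [tF2 tF3]]; rewrite !big_allpairs_dep !big_map /=.
  rewrite -[LHS]/(sw (d (r u)) (fun a c => sw (d a) (fun a' b => F a' b (q c)))).
  rewrite (@sw_coassoc _ _ hC X (fun a b c => F a b (q c))); last first.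
    split; first by move=> y z; apply: tF1.
    split; first by move=> x z; apply: tF2.
    by move=> x y; apply: (lin_comp (tF3 x y)).
  rewrite -[RHS]/(sw (d (r u)) (fun a b =>
    \sum_(p <- [seq (p.1, q p.2) | p <- d (r (q b))]) F a p.1 p.2)).
  by apply: eq_sw => a b; rewrite big_map; apply/esym/(swq X (F a)).
- move=> u; rewrite big_map /=.
  by rewrite -[RHS]rK; apply: (sw_counitl hC (r u) lq).
Qed.
End Comodules.

Section Coflat.
Variables (k : fieldType) (B C : algType k) (hB : hopf B) (hC : hopf C) (pi : B -> C).
Hypothesis hp : is_hopf_map hB hC pi.
Hypothesis coflat : faithfully_coflat hB hC pi.

Lemma coflat_lift n (g : 'I_n -> dual C) (c : 'I_n -> C) :
  \sum_i contract hC (g i) (c i) = 1 ->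
  exists b : 'I_n -> B, \sum_i sw (hdelta hB (b i)) (fun x y => g i (pi y) *: x) = 1.
Proof.
move=> c1; have [lp p1 pM _ pE] := hp.
have lg i := lin_contract hC (dual_linf (g i)).
have le i := @lin_ffun_eval k C n i.
have ls := @lin_single k C n.
pose theta (y : {ffun 'I_n -> C}) := \sum_i contract hC (g i) (y i).
have lth : lin theta.
  by apply: lin_bigsum => i; apply: (lin_comp (lg i) (le i)).
have thS i x : theta (single i x) = contract hC (g i) x.
  rewrite /theta (bigD1 i) //= ffunE eqxx big1 ?addr0 // => j ji.
  by rewrite ffunE (negPf ji) (lin0 (lg j)).
have dth (X : lmodType k) (F : C -> C -> X) y : bilin F ->
    sw (hdelta hC (theta y)) F = sw (cofree_coaction hC y) (fun a b => F a (theta b)).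
  move=> bF; rewrite sw_cofree.
  rewrite (lin_sum _ _ (_ : lin (fun x => sw (hdelta hC x) F))); last by lin_tac.
  apply: eq_bigr => i _; rewrite sw_contract //; last exact: dual_linf.
  by apply: eq_sw => a b; rewrite thS.
have sI : is_subspace (fun x => exists y, x = theta y).
  split; first by exists 0; rewrite (lin0 lth).
  by move=> a _ _ [y ->] [z ->]; exists (a *: y + z); rewrite lth.
have [W [q [r [lq rK q0]]]] := quotient_exists sI.
have qth y : q (theta y) = 0 by apply/q0; exists y.
have [cQ mQ] : is_lcomod hC (fun u => [seq (p.1, q p.2) | p <- hdelta hC (r u)]) /\
    is_comod_map (hdelta hC) (fun u => [seq (p.1, q p.2) | p <- hdelta hC (r u)]) q.
  apply: quotient_comodule => // _ X F bF /q0[y ->].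
  rewrite dth; last by lin_tac.
  rewrite -[RHS](sw0 _ (cofree_coaction hC y)); apply: eq_sw => a b.
  by rewrite qth (lin0 (bF.2 a)).
have mth : is_comod_map (cofree_coaction hC (n := n)) (hdelta hC) theta.
  by split=> // y X F bF; rewrite big_map; apply: dth.
have [ex _] := coflat (cofree_comodule hC n) (regular_comodule hC) cQ mth mQ.
(* The element 1 (x) 1 of the cotensor product of B with C dies in the quotient, because 1 is in the
   image of [theta]; exactness lifts it to v. *)
have [|_ /(_ [:: (1, 1)])] := ex.
  by split=> // x /q0.
case=> [||v [vcot vE]].
- move=> X F [tF1 [tF2 tF3]]; rewrite !big_allpairs_dep !big_seq1 /=.
  rewrite -[LHS]/(sw (hdelta hB 1) (fun x y => F x (pi y) 1)).
  rewrite -[RHS]/(sw (hdelta hC 1) (F 1)) !sw_one ?p1 //.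
  split; first by move=> y; apply: tF1.
  by move=> x; apply: (lin_comp (tF2 x 1)).
- move=> X F bF; rewrite big_map big_seq1 big_nil /=.
  rewrite (_ : q 1 = 0) ?(lin0 (bF.2 1)) //.
  by rewrite -c1 -(qth [ffun i => c i]) /theta; congr (q _); apply: eq_bigr => i _; rewrite ffunE.
have leps : @lin _ _ k^o (heps hC) := linf_counit hC.
have epsg i x : heps hC (contract hC (g i) x) = g i x.
  have lgi : @lin _ _ k^o (g i) := dual_linf (g i).
  rewrite /contract (lin_sw_out _ _ leps) -[RHS](sw_counitl hC x lgi).
  by apply: (eq_sw (X := k^o)) => a b; rewrite (linZ _ _ leps) /GRing.scale /= mulrC.
have lge i : linf (fun y : {ffun 'I_n -> C} => heps hC (y i)).
  exact: (lin_comp leps (le i)).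
have {}vE : \sum_(p <- v) \sum_i g i (p.2 i) *: p.1 = 1.
  have := vE B (fun x c => heps hC c *: x); rewrite big_map big_seq1 /=.
  rewrite (counit1 hC) scale1r => <-; last by lin_tac.
  apply: eq_bigr => p _; rewrite /theta (lin_sum _ _ leps) scaler_suml.
  by apply: eq_bigr => i _; rewrite epsg.
(* These b_i come from v by applying the counit to its i-th component. The cotensor condition,
   tested on the F below, trades g_i(pi(b_2)) for g_i at that component. *)
exists (fun i => \sum_(p <- v) heps hC (p.2 i) *: p.1).
pose F (x : B) (a : C) (y : {ffun 'I_n -> C}) := \sum_i (g i a * heps hC (y i)) *: x.
have tF : trilin F by rewrite /F; lin_tac.
have := vcot B F tF; rewrite !big_allpairs_dep /= => E.
transitivity (\sum_(p <- v) sw (hdelta hB p.1) (fun x y => F x (pi y) p.2)).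
  under eq_bigr => i _.
    rewrite (lin_sum _ _ (_ : lin (fun b => sw (hdelta hB b) (fun x y => g i (pi y) *: x))));
      last by lin_tac.
    over.
  rewrite exchange_big /=; apply: eq_bigr => p _.
  rewrite /F sw_sum; apply: eq_bigr => i _.
  rewrite (linZ _ _ (_ : lin (fun b => sw (hdelta hB b) (fun x y => g i (pi y) *: x))));
    last by lin_tac.
  by rewrite -sw_scale; apply: eq_sw => x y; rewrite scalerA mulrC.
apply: (etrans E); rewrite -vE; apply: eq_bigr => p _.
rewrite -[LHS]/(sw (cofree_coaction hC p.2) (F p.1)) sw_cofree; apply: eq_bigr => i _.
rewrite -(sw_counitr hC (p.2 i) (_ : lin (fun z => g i z *: p.1))); last by lin_tac.
apply: eq_sw => a b; rewrite /F (bigD1 i) //= ffunE eqxx big1 ?addr0 => [|j ji].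
  by rewrite scalerA mulrC.
by rewrite ffunE (negPf ji) (lin0 leps) mulr0 scale0r.
Qed.

Lemma co_frobenius_coflat_quotient : co_frobenius hB -> co_frobenius hC.
Proof.
move/co_frobenius_hop/co_frobeniusP=> [int il [z0 z0P]].
have [lp p1 pM _ pE] := hp.
have lint : @lin _ B k^o int := il.1.
pose be := (int z0)^-1 *: z0 : B.
have be1 : int be = 1 by rewrite /be (linZ _ _ lint) /GRing.scale /= mulVf.
(* The form of strong invariance for a right integral, read off in [hop hB]. *)
have inv (x y : B) : sw (hdelta hB x) (fun a b => int (a * y) *: b) =
    sw (hdelta hB y) (fun a b => int (x * a) *: hS hB b).
  by have := strong_invariance il x y; rewrite !sw_hop.
pose zs := [seq pi (hS hB q.2) | q <- hdelta hB be].
(* If f vanishes on [P], then g(f(y_1) y_2) = f(y_1 g(y_2)) = 0 for every g killing [zs]. Arbitrary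
   n makes [P] a subspace. *)
pose P (y : C) := exists n (g : 'I_n -> dual C) (c : 'I_n -> C),
  (forall i z, z \in zs -> g i z = 0) /\ y = \sum_i contract hC (g i) (c i).
have lg (g : dual C) := lin_contract hC (dual_linf g).
have sP : is_subspace P.
  split.
    exists 0, (fun _ => Dual (linf_counit hC)), (fun _ => 0); split=> [[]//|].
    by rewrite big_ord0.
  move=> a x y [n [g [c [g0 ->]]]] [m [g' [c' [g'0 ->]]]].
  exists (n + m)%N, (fun i => match split i with inl j => g j | inr j => g' j end),
    (fun i => match split i with inl j => a *: c j | inr j => c' j end); split.
    by move=> i z zz; case: (split i) => j; [apply: g0|apply: g'0].
  rewrite big_split_ord /= scaler_sumr; congr (_ + _); apply: eq_bigr => i _.
    by rewrite (unsplitK (inl i)) (linZ _ _ (lg (g i))).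
  by rewrite (unsplitK (inr i)).
(* After lifting, int(be) is a sum of terms g(pi(int(b_1 be) b_2)) = g(pi(int(b be_1) S(be_2))), and
   g kills the pi(S(be_2)). *)
have nP1 : ~ P 1.
  case=> n [g [c [g0 /esym c1]]]; have [b b1] := coflat_lift c1.
  have : int be = 0; last by rewrite be1 => /eqP; rewrite oner_eq0.
  rewrite -[be]mul1r -b1 mulr_suml (lin_sum _ _ lint) big1 // => i _.
  have lgi : @lin _ _ k^o (g i) := dual_linf (g i).
  have lgp : @lin _ _ k^o (fun x => g i (pi x)) by lin_tac.
  rewrite (lin_sw_out _ _ (_ : @lin _ _ k^o (fun x => int (x * be)))); last by lin_tac.
  transitivity (g i (pi (sw (hdelta hB (b i)) (fun x y => int (x * be) *: y)))).
    rewrite (lin_sw_out _ _ lgp); apply: (eq_sw (X := k^o)) => x y.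
    by rewrite (linZ _ _ lgp) -scalerAl (linZ _ _ lint) /GRing.scale /= mulrC.
  rewrite inv (lin_sw_out _ _ lgp) /sw big_seq big1 // => q qbe.
  by rewrite (linZ _ _ lgp) g0 ?scaler0 //; apply/mapP; exists q.
have [f [lf fP f1]] := separation sP nP1.
have lf' : @lin _ _ k^o f := lf.
have fspan y : span zs (sw (hdelta hC y) (fun a b => f a *: b)).
  move=> g lg' g0; have lg'' : @lin _ _ k^o g := lg'.
  rewrite (lin_sw_out _ _ lg'') -(fP (contract hC g y)).
    rewrite /contract (lin_sw_out _ _ lf'); apply: (eq_sw (X := k^o)) => a b.
    by rewrite (linZ _ _ lf') (linZ _ _ lg'') /GRing.scale /= mulrC.
  by exists 1, (fun _ => Dual lg'), (fun _ => y); split=> //; rewrite big_ord1.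
have [t tP] := finite_projection zs.
have lT : lin (fun y => sw (hdelta hC y) (fun a b => f a *: b)) by lin_tac.
have lh (g : dual C) : linf (fun y => g (sw (hdelta hC y) (fun a b => f a *: b))).
  exact: (lin_comp (dual_linf g : @lin _ _ k^o _) lT).
(* It is f(y_1) y_2 that has finite rank, so f is rational for the reversed structure. *)
apply: co_frobenius_of_hop.
apply: (@co_frobenius_of_rational _ _ (hop hC) f
  [seq (p.1, Dual (lh p.2)) | p <- t] lf _ 1); last by rewrite f1 oner_eq0.
move=> y; rewrite sw_hop big_map /=.
exact: tP (fspan y).
Qed.
End Coflat.

Theorem theorem2p11 (k : fieldType) (A B C : algType k)
  (hA : hopf A) (hB : hopf B) (hC : hopf C) (iota : A -> B) (pi : B -> C) :
  exact_hopf_seq hA hB hC iota pi ->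
  faithfully_coflat hB hC pi ->
  (co_frobenius hB <-> co_frobenius hA /\ co_frobenius hC).
Proof.
move=> ex coflat; split=> [cB|[cA cC]]; last exact: co_frobenius_extension ex cA cC.
have [[hi hp] inj _ _ _] := ex; split.
  exact: co_frobenius_sub hi inj cB.
exact: co_frobenius_coflat_quotient hp coflat cB.
Qed.
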